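(* Let $d\ge1$, $0<\rho<1$, and let $(\mu_n)_{n\ge1}$ be a sequence of probability measures on $\Omega_n$. Let $H_n(t)=H_n(\mu_nS^n(t)\,|\,\nu^n_\rho)$. Then there exists a finite constant $C_0=C_0(\rho)$ (depending on $\rho$ and on the fixed data $d$, $(c_j)_j$, $(a_n)_n$ of the model, but not on $n$, $t$ or $(\mu_n)$) such that $$H_n'(t)\;\le\;C_0\,a_n\,\{H_n(t)+R_d(n)\}$$ for all $t\ge0$, where $R_1(n)=\sqrt{a_n}$, $R_2(n)=a_n\log n$, and $R_d(n)=a_n\,n^{d-2}$ for $d\ge3$.
   Context: Model (voter model with stirring). $\mathbb T^d_n=(\mathbb Z/n\mathbb Z)^d$, $\Omega_n=\{0,1\}^{\mathbb T^d_n}$, $\eta=(\eta_x)_{x\in\mathbb T^d_n}$; $\|\cdot\|$ is the $\ell^1$ norm; $e_1,\dots,e_d$ is the canonical basis; $(\tau_x\eta)_z=\eta_{x+z}$; $\sigma^x\eta$ is $\eta$ with the value at $x$ replaced by $1-\eta_x$; $\sigma^{x,y}\eta$ is $\eta$ with the values at $x$ and $y$ exchanged. A cylinder function is a real function on $\{0,1\}^{\mathbb Z^d}$ depending on finitely many coordinates; it is evaluated at $\eta\in\Omega_n$ by identifying $\eta$ with its $n$-periodic extension, and $n\ge3$ is always taken large enough that the supports of the cylinder functions involved, together with $0$ and $e_j$, project injectively to $\mathbb T_n^d$. Fixed cylinder functions $c_j$, $1\le j\le d$, satisfy $c_j\ge\mathfrak c_0>0$, $c_j$ does not depend on $\eta_0,\eta_{e_j}$,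 and there are cylinder functions $h_{j,k}$ with $c_j(\eta)[\eta_{e_j}-\eta_0]=\sum_{k=1}^d\{h_{j,k}(\tau_{e_k}\eta)-h_{j,k}(\eta)\}$. Generators: $(L_n^Sf)(\eta)=\sum_{x}\sum_{j=1}^dc_j(\tau_x\eta)\{f(\sigma^{x,x+e_j}\eta)-f(\eta)\}$, $(L_n^Vf)(\eta)=\sum_x\sum_{y:\|y-x\|=1}(\eta_y-\eta_x)^2[f(\sigma^x\eta)-f(\eta)]$, $L_n=n^2L_n^S+a_nL_n^V$, where $(a_n)$ is a fixed sequence of positive numbers with $a_n\to\infty$ and $a_n/n^2\to0$. $S^n(t)$ is the semigroup generated by $L_n$, so that $\mu S^n(t)$ is the law at time $t$ of the chain started from $\mu$. $\nu^n_\rho$ is the Bernoulli product measure of density $\rho$ on $\Omega_n$; $H_n(\mu|\nu)=\int\log(d\mu/d\nu)\,d\mu$ is the relative entropy. $H_n'$ is the time derivative (at $t=0$ the right derivative, which may be $-\infty$). *)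

(* Defs.v *)
From HB Require Import structures.
From mathcomp Require Import all_boot all_order all_algebra.
From mathcomp Require Import all_classical all_reals all_analysis.

Set Implicit Arguments.
Unset Strict Implicit.
Unset Printing Implicit Defensive.

Import Order.TTheory GRing.Theory Num.Theory.
Import numFieldNormedType.Exports.

Local Open Scope classical_set_scope.
Local Open Scope ring_scope.

Definition unit_vec (A : pzRingType) (d : nat) (j : 'I_d) : 'rV[A]_d :=
  delta_mx 0 j.

Section Configurations.
Variable V : zmodType.
Implicit Types (x y : V) (eta : V -> bool).

Definition translate x eta : V -> bool := fun z => eta (x + z).

Definition flip_at x eta : V -> bool :=
  fun z => if z == x then ~~ eta x else eta z.

Definition exchange x y eta : V -> bool :=
  fun z => if z == x then eta y else if z == y then eta x else eta z.

End Configurations.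

Definition config (d : nat) := 'rV[int]_d -> bool.

Section Cylinder.
Variables (R : realType) (d : nat).
Implicit Types f : config d -> R.

Definition cylinder f : Prop :=
  exists A : seq 'rV[int]_d, forall w w' : config d,
    {in A, w =1 w'} -> f w = f w'.

(* The coordinates on which f depends; for a cylinder function this is the
   smallest set A satisfying the condition in [cylinder]. *)
Definition dep_support f : set 'rV[int]_d :=
  [set z | exists w : config d, f (flip_at z w) != f w].

Definition gradient_condition (c : 'I_d -> config d -> R) : Prop :=
  exists h : 'I_d -> 'I_d -> config d -> R,
    (forall j k, cylinder (h j k)) /\
    (forall j (w : config d),
      c j w * ((w (unit_vec int j))%:R - (w 0)%:R) =
      \sum_(k < d) (h j k (translate (unit_vec int k) w) - h j k w)).

End Cylinder.

(* 'Z_n is Z/nZ only for 1 < n; everything below is used with 3 <= n. *)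
Definition torus (d n : nat) : finZmodType := 'rV['Z_n]_d.

Definition Omega (d n : nat) : finType := {ffun torus d n -> bool}.

Definition torus_proj (d n : nat) (z : 'rV[int]_d) : torus d n :=
  map_mx (fun k : int => k%:~R) z.

Definition periodic (d n : nat) (eta : torus d n -> bool) : config d :=
  fun z => eta (torus_proj n z).

Definition torus_norm (d n : nat) (x : torus d n) : nat :=
  (\sum_(j < d) minn (x 0%R j) (n - x 0%R j))%N.

Definition large_enough (R : realType) (d : nat) (c : 'I_d -> config d -> R)
    (n : nat) : Prop :=
  (3 <= n)%N /\
  forall j, {in dep_support (c j) `|` [set 0; unit_vec int j] &,
    injective (@torus_proj d n)}.

Section Generator.
Variables (R : realType) (d n : nat).
Implicit Types (f : Omega d n -> R) (eta : Omega d n).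

Definition gen_stirring (c : 'I_d -> config d -> R) f eta : R :=
  \sum_(x : torus d n) \sum_(j < d)
    c j (periodic (translate x eta)) *
    (f (finfun (exchange x (x + unit_vec 'Z_n j) eta)) - f eta).

Definition gen_voter f eta : R :=
  \sum_(x : torus d n) \sum_(y : torus d n | torus_norm (y - x) == 1%N)
    ((eta y)%:R - (eta x)%:R) ^+ 2 * (f (finfun (flip_at x eta)) - f eta).

(* [an] is the n-th term of the sequence (a_n). *)
Definition gen (c : 'I_d -> config d -> R) (an : R) f eta : R :=
  n%:R ^+ 2 * gen_stirring c f eta + an * gen_voter f eta.

(* The semigroup exp(tL) of a bounded operator L on functions on the finite
   set Omega, by the exponential series. *)
Definition semigroup (L : (Omega d n -> R) -> Omega d n -> R) (t : R) f eta
    : R :=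
  limn (series (fun k : nat => t ^+ k / k`!%:R * iter k L f eta)).

(* Measures on the finite set Omega are given by their mass functions. *)
Definition is_probability (mu : Omega d n -> R) : Prop :=
  (forall eta, 0 <= mu eta) /\ \sum_eta mu eta = 1.

Definition law_at (L : (Omega d n -> R) -> Omega d n -> R) (mu : Omega d n -> R)
    (t : R) : Omega d n -> R :=
  fun xi => \sum_eta mu eta * semigroup L t (fun zeta => (zeta == xi)%:R) eta.

Definition bernoulli_product (rho : R) : Omega d n -> R :=
  fun eta => \prod_(x : torus d n) (if eta x then rho else 1 - rho).

(* Only used with nu > 0 everywhere; the convention 0 log 0 = 0 is respected
   because the product with mu eta = 0 vanishes. *)
Definition relative_entropy (mu nu : Omega d n -> R) : R :=
  \sum_eta mu eta * ln (mu eta / nu eta).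

Definition entropy (c : 'I_d -> config d -> R) (an rho : R)
    (mu : Omega d n -> R) (t : R) : R :=
  relative_entropy (law_at (gen c an) mu t) (bernoulli_product rho).

End Generator.

(* [l] is the derivative of H at t > 0, or its right derivative, with values in
   the extended reals, at t = 0. *)
Definition is_time_derivative (R : realType) (H : R -> R) (t : R) (l : \bar R)
    : Prop :=
  if t == 0 then ((H h - H 0) / h)%:E @[h --> 0^'+] --> l
  else exists2 r : R, l = r%:E & is_derive t 1 H r.

Definition entropy_error (R : realType) (d : nat) (an : R) (n : nat) : R :=
  if d == 1%N then Num.sqrt an
  else if d == 2%N then an * ln n%:R
  else an * n%:R ^+ (d - 2).

(* Main.v *)
Require Import Defs.
From HB Require Import structures.
From mathcomp Require Import all_boot all_order all_algebra.
From mathcomp Require Import all_classical all_reals all_analysis.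
From mathcomp Require Import perm ring lra.

(** Write f for the density of the law at time t with respect to the Bernoulli
    measure and w for the centered configuration.  From ln y <= 2 (sqrt y - 1)
    the entropy production is at most minus the Dirichlet form of sqrt f under
    the stirring plus the integral of f against L^* 1.  The stirring is
    reversible, so L^* 1 only comes from the voter dynamics and equals
    a_n / (rho (1 - rho)) times the sum of w_x w_y over neighbours x, y.

    To bound the correlations, w_(x + e_j) is replaced by its average over a box
    of side l.  The difference of the point mass and the box average is the
    divergence of an explicit flow, so that the error can be integrated by parts
    against the stirring and absorbed by the Dirichlet form; what remains are
    quadratic forms in w.

    These are controlled by entropy without exponential moments.  Reveal the
    sites one by one and write w = p + xi, where p is the conditional mean given
    the sites already revealed.  The increments xi are orthogonal and bounded,
    and by the chain rule and Pinsker's inequality the mean of |p|^2 is at most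
    twice the entropy.  A convolution by K therefore contributes ||K||_1^2 H
    from p and n^d ||K||_2^2 from xi.  The choice l ~ n / sqrt a_n balances the
    terms; when a_n < 9 or a_n > n^2 the trivial bound n^d on the correlations
    suffices. *)

Set Implicit Arguments.
Unset Strict Implicit.
Unset Printing Implicit Defensive.

Import Order.TTheory GRing.Theory Num.Theory.
Import numFieldNormedType.Exports.

Local Open Scope classical_set_scope.
Local Open Scope ring_scope.

(** * Exponential series and finite jump kernels *)

Section ExponentialSeries.
Variable R : realType.
Implicit Types (b : nat -> R) (t : R).

Definition egf b t : R := limn (series (fun k : nat => t ^+ k / k`!%:R * b k)).

(** The growth of the iterates of a bounded operator. It makes the exponential series converge for
    every [t] and survives the index shift caused by differentiation. *)
Definition geom_bounded b : Prop :=
  exists M B : R, 0 <= B /\ forall k, `|b k| <= M * B ^+ k.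

Lemma geom_boundedS b : geom_bounded b -> geom_bounded (fun k => b k.+1).
Proof.
move=> [M [B [B0 H]]]; exists (M * B), B; split=> // k.
by rewrite -mulrA -exprS.
Qed.

Lemma is_cvg_egf b t : geom_bounded b ->
  cvgn (series (fun k : nat => t ^+ k / k`!%:R * b k)).
Proof.
move=> [M [B [B0 H]]]; apply: normed_cvg.
apply: (@series_le_cvg _ _ (M *: exp_coeff (`|t| * B))) => [n|n|n|].
- by rewrite /= normr_ge0.
- rewrite /GRing.scale /= /exp_coeff /=.
  apply: mulr_ge0; last by rewrite divr_ge0 ?exprn_ge0 ?mulr_ge0.
  by have := le_trans (normr_ge0 _) (H 0%N); rewrite expr0 mulr1.
- rewrite /GRing.scale /= /exp_coeff /= !normrM normfV normrX exprMn.
  rewrite [`|n`!%:R|]ger0_norm//.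
  rewrite [_ *: _]/( _ * _) [leRHS](_ : _ = `|t| ^+ n / n`!%:R * (M * B ^+ n)); last first.
    rewrite [LHS]mulrC -[LHS]mulrA [_ * M]mulrC -!mulrA; congr (_ * _).
    by rewrite mulrCA [RHS]mulrCA; congr (_ * _); rewrite mulrC.
  by rewrite ler_wpM2l // divr_ge0 ?exprn_ge0.
- exact/is_cvg_seriesZ/is_cvg_series_exp_coeff.
Qed.

Lemma is_derive_egf b t : geom_bounded b ->
  is_derive t 1 (egf b) (egf (fun k => b k.+1) t).
Proof.
move=> bb.
have E b' s : (fun k : nat => s ^+ k / k`!%:R * b' k)
    = (fun k => (b' k / k`!%:R) * s ^+ k).
  by apply/funext => k; rewrite mulrC mulrA mulrAC.
have D b' : pseries_diffs (fun k => b' k / k`!%:R)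
    = (fun k => b' k.+1 / k`!%:R).
  by apply/funext => k; rewrite /pseries_diffs factS natrM invfM mulrCA mulVKf ?pnatr_eq0.
have -> : egf b = (fun x => limn (pseries (fun k => b k / k`!%:R) x)).
  by apply/funext => s; rewrite /egf E.
have -> : egf (fun k => b k.+1) t
    = limn (pseries (pseries_diffs (fun k => b k / k`!%:R)) t).
  by rewrite D /egf E.
have b1 := geom_boundedS bb; have b2 := geom_boundedS b1.
(* Termwise differentiation at [t] needs the series and its first two formal derivatives to converge
   at a point of larger modulus. *)
apply: (@pseries_snd_diffs _ _ (`|t| + 1)).
- by have := @is_cvg_egf _ (`|t| + 1) bb; rewrite E.
- by have := @is_cvg_egf _ (`|t| + 1) b1; rewrite E D.
- by have := @is_cvg_egf _ (`|t| + 1) b2; rewrite E !D.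
- by rewrite [ltRHS]ger0_norm ?addr_ge0 // ltrDl.
Qed.

Lemma egf_sum (I : finType) (a : I -> R) (b : I -> nat -> R) t :
  (forall i, geom_bounded (b i)) ->
  egf (fun k => \sum_i a i * b i k) t = \sum_i a i * egf (b i) t.
Proof.
move=> bb; rewrite /egf.
apply: cvg_lim => //.
have -> : series (fun k => t ^+ k / k`!%:R * (\sum_i a i * b i k)) =
  (fun n => \sum_i a i * series (fun k => t ^+ k / k`!%:R * b i k) n).
  apply/funext => n; rewrite /series /=.
  under eq_bigr do rewrite mulr_sumr.
  rewrite exchange_big /=; apply: eq_bigr => i _.
  by rewrite mulr_sumr; apply: eq_bigr => k _; rewrite mulrCA.
apply: (cvg_big add_continuous) => i _.
apply: cvgM; [exact: cvg_cst | exact: is_cvg_egf].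
Qed.

Lemma egf0 b : egf b 0 = b 0%N.
Proof.
rewrite /egf; apply: lim_near_cst => //; exists 1%N => // n /= n0.
rewrite /series /= big_ltn // expr0 fact0 divr1 mul1r big_nat_cond big1 ?addr0//.
by move=> [|k] //= _; rewrite exprS !mul0r.
Qed.

Lemma egf_ge_term b t k : geom_bounded b -> (forall j, 0 <= b j) -> 0 <= t ->
  t ^+ k / k`!%:R * b k <= egf b t.
Proof.
move=> bb b0 t0.
have term_ge0 j : 0 <= t ^+ j / j`!%:R * b j.
  by rewrite mulr_ge0 // divr_ge0 ?exprn_ge0.
have := @nondecreasing_cvgn_le R (series (fun k : nat => t ^+ k / k`!%:R * b k))
   _ (@is_cvg_egf _ t bb) k.+1.
move=> H; apply: le_trans (H _).
  by rewrite /series /= big_nat_recr //= lerDr sumr_ge0.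
exact: nondecreasing_series.
Qed.

Lemma egf_eq0 b t : (forall k, b k = 0) -> egf b t = 0.
Proof.
move=> b0; rewrite /egf; apply: lim_near_cst => //; exists 0%N => // n _.
by rewrite /series /= big1 // => k _; rewrite b0 mulr0.
Qed.

End ExponentialSeries.

(** * Semigroups of kernels on a finite set *)

Section FiniteKernel.
Variables (R : realType) (O : finType).
Implicit Types (f m : O -> R) (q : O -> O -> R) (t : R).

Definition kernel_op q f : O -> R := fun x => \sum_y q x y * f y.
Definition kernel_adj q m : O -> R := fun y => \sum_x m x * q x y.

Lemma kernel_op_geom q f x : geom_bounded (fun k => iter k (kernel_op q) f x).
Proof.
(* The sum of all absolute entries dominates every row sum of [q], hence each application of the
   operator. *)
exists (\sum_y `|f y|), (\sum_y \sum_z `|q y z|); split.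
  by apply: sumr_ge0 => y _; apply: sumr_ge0.
move=> k; elim: k x => [|k IH] x.
  by rewrite expr0 mulr1 /= (bigD1 x) //= lerDl sumr_ge0.
rewrite /= /kernel_op; apply: le_trans (ler_norm_sum _ _ _) _.
rewrite exprS mulrCA.
apply: (@le_trans _ _ (\sum_y `|q x y| * ((\sum_y `|f y|) * (\sum_y \sum_z `|q y z|) ^+ k))).
  by apply: ler_sum => y _; rewrite normrM ler_wpM2l.
rewrite -mulr_suml ler_wpM2r //.
  rewrite mulr_ge0 ?sumr_ge0 ?exprn_ge0 // ?sumr_ge0 // => y _; exact: sumr_ge0.
by rewrite [leRHS](bigD1 x) //= lerDl; apply: sumr_ge0 => y _; apply: sumr_ge0.
Qed.

Lemma kernel_adj_geom q m y : geom_bounded (fun k => iter k (kernel_adj q) m y).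
Proof.
have E : kernel_adj q = kernel_op (fun x y => q y x).
  by apply/funext => f; apply/funext => x; apply: eq_bigr => z _; rewrite mulrC.
by rewrite E; exact: kernel_op_geom.
Qed.

Lemma kernel_adjE q m f :
  \sum_y kernel_adj q m y * f y = \sum_x m x * kernel_op q f x.
Proof.
under eq_bigr do rewrite /kernel_adj mulr_suml.
rewrite exchange_big /=; apply: eq_bigr => x _.
by rewrite mulr_sumr; apply: eq_bigr => y _; rewrite mulrA.
Qed.

Lemma is_derive_egf_op q f x t :
  is_derive t 1 (egf (fun k => iter k (kernel_op q) f x))
    (kernel_op q (fun y => egf (fun k => iter k (kernel_op q) f y) t) x).
Proof.
apply: is_derive_eq; first exact/is_derive_egf/kernel_op_geom.
rewrite [RHS](_ : _ = \sum_y q x y * egf (fun k => iter k (kernel_op q) f y) t) //.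
by rewrite -egf_sum // => y; exact: kernel_op_geom.
Qed.

Lemma is_derive_egf_adj q m y t :
  is_derive t 1 (egf (fun k => iter k (kernel_adj q) m y))
    (kernel_adj q (fun x => egf (fun k => iter k (kernel_adj q) m x) t) y).
Proof.
apply: is_derive_eq; first exact/is_derive_egf/kernel_adj_geom.
rewrite [RHS](_ : _ = \sum_x q x y * egf (fun k => iter k (kernel_adj q) m x) t).
  rewrite -egf_sum; last by move=> x; exact: kernel_adj_geom.
  by congr egf; apply/funext => k; apply: eq_bigr => x _; rewrite mulrC.
by apply: eq_bigr => x _; rewrite mulrC.
Qed.

Lemma is_derive_sumf (I : finType) (h : I -> R -> R) (t : R) (dh : I -> R) :
  (forall i, is_derive t 1 (h i) (dh i)) ->
  is_derive t 1 (fun s => \sum_i h i s) (\sum_i dh i).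
Proof.
move=> H.
have -> : (fun s => \sum_i h i s) = \sum_(i < #|I|) h (enum_val i).
  apply/funext => s; rewrite fct_sumE (reindex_onto enum_val enum_rank) /=.
    by apply: eq_big => // i; rewrite enum_valK eqxx.
  by move=> i _; rewrite enum_rankK.
have -> : \sum_i dh i = \sum_(i < #|I|) dh (enum_val i).
  rewrite (reindex_onto enum_val enum_rank) /=.
    by apply: eq_big => // i; rewrite enum_valK eqxx.
  by move=> i _; rewrite enum_rankK.
by apply: is_derive_sum => i.
Qed.

(* exp(tQ) = exp(-lam t) exp(t(Q + lam)); for lam large, Q + lam has
   nonnegative entries, which makes signs and supports visible on the series. *)
Lemma egf_shift q (lam : R) m (z : O) (T : R) :
  let q' := fun x y => q x y + lam * (x == y)%:R in
  \sum_x m x * egf (fun k => iter k (kernel_op q) (fun y => (y == z)%:R) x) T =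
  expR (- (lam * T)) * egf (fun k => iter k (kernel_adj q') m z) T.
Proof.
move=> q'.
pose v y s := egf (fun k => iter k (kernel_adj q') m y) s.
pose G y s := egf (fun k => iter k (kernel_op q) (fun y => (y == z)%:R) y) s.
(* [phi] interpolates between the two sides: the mass has moved forward for time [s] under [q'], the
   test function backward for time [T - s] under [q]. Duality of [kernel_op] and [kernel_adj] makes
   its derivative vanish, the exponential absorbing [lam]. *)
pose phi s := expR (- (lam * s)) * \sum_y v y s * G y (T - s).
have dphi (s : R) : is_derive s 1 phi 0.
  have dv y : is_derive s 1 (v y) (kernel_adj q' (v^~ s) y).
    exact: is_derive_egf_adj.
  have dG y : is_derive s 1 (fun s => G y (T - s))
      (- kernel_op q (G^~ (T - s)) y).
    have := @is_derive_egf_op q (fun y => (y == z)%:R) y (T - s).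
    move=> dg.
    have d1 : is_derive s (1 : R) (fun s : R => T - s) (- 1).
      by apply: is_derive_eq; rewrite add0r mul1r.
    have := @is_derive1_comp R (G y) (fun s => T - s) _ _ _ dg d1.
    by rewrite mulrN1.
  have dE : is_derive s 1 (fun s => expR (- (lam * s)))
      (- lam * expR (- (lam * s))).
    have d1 : is_derive s (1 : R) (fun s : R => - (lam * s)) (- lam).
      by apply: is_derive_eq; rewrite /GRing.scale /= mulr1.
    have := @is_derive1_comp R expR (fun s => - (lam * s)) _ _ _ (is_derive_expR _) d1.
    by rewrite mulrC.
  have dS : is_derive s 1 (fun s => \sum_y v y s * G y (T - s))
     (\sum_y (v y s *: (- kernel_op q (G^~ (T - s)) y) +
              G y (T - s) *: kernel_adj q' (v^~ s) y)).
    by apply: is_derive_sumf => y; exact: (is_deriveM (dv y) (dG y)).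
  apply: (is_derive_eq (is_deriveM dE dS)).
  rewrite /GRing.scale /= [in X in _ + X](mulrC _ (- lam * _)).
  rewrite [- lam * _]mulrC -!mulrA -mulrDr; apply/eqP; rewrite mulf_eq0.
  rewrite expR_eq0 orFb; apply/eqP.
  rewrite big_split /=.
  under [X in _ + X + _]eq_bigr do rewrite mulrC.
  rewrite kernel_adjE -big_split /= mulr_sumr -big_split /=.
  apply: big1 => y _.
  rewrite [kernel_op q' _ _](_ : _ = kernel_op q (G^~ (T - s)) y + lam * G y (T - s)).
    ring.
  rewrite /kernel_op /q' (eq_bigr (fun y0 => q y y0 * G y0 (T - s) + lam * (y == y0)%:R * G y0 (T - s))).
    rewrite big_split /=; congr (_ + _).
    rewrite (bigD1 y) //= eqxx mulr1 big1 ?addr0 // => w wy.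
    by rewrite eq_sym (negbTE wy) mulr0 mul0r.
  by move=> w _; rewrite mulrDl.
have E := is_derive_0_is_cst T 0 dphi.
have := esym E; rewrite /phi mulr0 oppr0 expR0 mul1r addr0 subrr.
under eq_bigr do rewrite /v egf0 /=; move=> ->.
congr (_ * _).
rewrite (bigD1 z) //= /G egf0 /= eqxx mulr1 big1 ?addr0 // => y yz.
by rewrite egf0 /= (negbTE yz) mulr0.
Qed.

End FiniteKernel.

(** * Laws of finite jump chains *)

Section JumpChain.
Variables (R : realType) (d n : nat) (B : finType).
Variables (r : B -> Omega d n -> R) (T : B -> Omega d n -> Omega d n).
Hypothesis r_ge0 : forall b x, 0 <= r b x.
Implicit Types (x y z : Omega d n) (f m nu : Omega d n -> R) (t : R).

Definition jump_gen f x : R := \sum_b r b x * (f (T b x) - f x).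

Definition jump_rate x y : R :=
  \sum_b r b x * ((T b x == y)%:R - (x == y)%:R).

(** A crude bound on the exit rate from any state: adding it on the diagonal makes all entries
    nonnegative. *)
Let rate_sum : R := \sum_b \sum_x r b x.
Let shifted_rate x y : R := jump_rate x y + rate_sum * (x == y)%:R.

Lemma jump_genE : jump_gen = kernel_op jump_rate.
Proof.
apply/funext => f; apply/funext => x; rewrite /jump_gen /kernel_op /jump_rate.
under [RHS]eq_bigr do rewrite mulr_suml.
rewrite exchange_big /=; apply: eq_bigr => b _.
under eq_bigr do rewrite -mulrA mulrBl.
have D z : \sum_y (z == y)%:R * f y = f z.
  rewrite (bigD1 z) //= eqxx mul1r big1 ?addr0 // => y yz.
  by rewrite eq_sym (negbTE yz) mul0r.
by rewrite -mulr_sumr sumrB !D.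
Qed.

Lemma jump_rate_ge0 x y : x != y -> 0 <= jump_rate x y.
Proof.
move=> xy; rewrite /jump_rate; apply: sumr_ge0 => b _.
by rewrite (negbTE xy) subr0 mulr_ge0.
Qed.

Lemma shifted_rate_ge0 x y : 0 <= shifted_rate x y.
Proof.
rewrite /shifted_rate; have [<-|xy] := eqVneq x y; last first.
  by rewrite mulr0 addr0 jump_rate_ge0.
rewrite mulr1 /jump_rate /rate_sum -big_split /=; apply: sumr_ge0 => b _.
rewrite eqxx mulrBr mulr1 -addrA addr_ge0 ?mulr_ge0 //.
by rewrite addrC subr_ge0 (bigD1 x) //= lerDl sumr_ge0.
Qed.

Lemma law_at_egf m t y : law_at jump_gen m t y =
  expR (- (rate_sum * t)) * egf (fun k => iter k (kernel_adj shifted_rate) m y) t.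
Proof. by rewrite -egf_shift -jump_genE. Qed.

Lemma iter_shifted_ge0 m k y : (forall x, 0 <= m x) ->
  0 <= iter k (kernel_adj shifted_rate) m y.
Proof.
move=> m0; elim: k y => [|k IH] y //=.
by apply: sumr_ge0 => x _; rewrite mulr_ge0 // shifted_rate_ge0.
Qed.

Lemma law_at0 m : law_at jump_gen m 0 = m.
Proof.
by apply/funext => y; rewrite law_at_egf mulr0 oppr0 expR0 mul1r egf0.
Qed.

Lemma law_at_ge0 m t y : (forall x, 0 <= m x) -> 0 <= t ->
  0 <= law_at jump_gen m t y.
Proof.
move=> m0 t0; rewrite law_at_egf mulr_ge0 ?expR_ge0 //.
apply: le_trans (@egf_ge_term _ _ t 0%N (@kernel_adj_geom _ _ _ _ _) _ t0) => /=.
  by rewrite expr0 fact0 divr1 mul1r.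
by move=> k; exact: iter_shifted_ge0.
Qed.

(** The series of the shifted kernel has nonnegative coefficients: either all vanish, or one
    positive term makes the sum positive at every [t > 0]. The support of the law is thus the same
    at all positive times. *)
Lemma law_at_eq0_or_gt0 m y : (forall x, 0 <= m x) ->
  (forall t, law_at jump_gen m t y = 0) \/
  (forall t, 0 < t -> 0 < law_at jump_gen m t y).
Proof.
move=> m0.
have [H|] := pselect (forall k, iter k (kernel_adj shifted_rate) m y = 0).
  by left => t; rewrite law_at_egf egf_eq0 ?mulr0.
move/existsNP => [k /eqP kn0]; right => t t0.
rewrite law_at_egf mulr_gt0 ?expR_gt0 //.
apply: lt_le_trans (@egf_ge_term _ _ t k (@kernel_adj_geom _ _ _ _ _) _ (ltW t0)).
  by rewrite mulr_gt0 ?divr_gt0 ?exprn_gt0 // lt_neqAle eq_sym kn0 iter_shifted_ge0.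
by move=> j; exact: iter_shifted_ge0.
Qed.

(** The forward Kolmogorov equation; the derivative of the exponential prefactor cancels the
    diagonal shift. *)
Lemma is_derive_law_at m t y :
  is_derive t 1 (fun s => law_at jump_gen m s y)
    (kernel_adj jump_rate (law_at jump_gen m t) y).
Proof.
set v := fun x s => egf (fun k => iter k (kernel_adj shifted_rate) m x) s.
have E x s : law_at jump_gen m s x = expR (- (rate_sum * s)) * v x s.
  exact: law_at_egf.
have -> : (fun s => law_at jump_gen m s y) =
    (fun s => expR (- (rate_sum * s)) * v y s).
  by apply/funext => s; exact: E.
have dE : is_derive t 1 (fun s => expR (- (rate_sum * s)))
    (- rate_sum * expR (- (rate_sum * t))).
  have d1 : is_derive t (1 : R) (fun s : R => - (rate_sum * s)) (- rate_sum).
    by apply: is_derive_eq; rewrite /GRing.scale /= mulr1.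
  have := @is_derive1_comp R expR (fun s => - (rate_sum * s)) _ _ _
    (is_derive_expR _) d1.
  by rewrite mulrC.
have dv : is_derive t 1 (v y) (kernel_adj shifted_rate (v^~ t) y).
  exact: is_derive_egf_adj.
apply: (is_derive_eq (is_deriveM dE dv)); rewrite /GRing.scale /=.
have -> : kernel_adj jump_rate (law_at jump_gen m t) y =
    expR (- (rate_sum * t)) * kernel_adj jump_rate (v^~ t) y.
  by rewrite /kernel_adj mulr_sumr; apply: eq_bigr => x _; rewrite E mulrA.
have -> : kernel_adj shifted_rate (v^~ t) y =
    kernel_adj jump_rate (v^~ t) y + rate_sum * v y t.
  rewrite /kernel_adj /shifted_rate.
  under eq_bigr do rewrite mulrDr.
  rewrite big_split /=; congr (_ + _).
  rewrite (bigD1 y) //= eqxx mulr1 mulrC big1 ?addr0 // => x xy.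
  by rewrite (negbTE xy) !mulr0.
ring.
Qed.

Lemma sum_kernel_adj_jump m : \sum_y kernel_adj jump_rate m y = 0.
Proof.
under eq_bigr do rewrite -[kernel_adj _ _ _]mulr1.
rewrite kernel_adjE -jump_genE big1 // => x _.
by rewrite /jump_gen big1 ?mulr0 // => b _; rewrite subrr mulr0.
Qed.

Lemma law_at_probability m t : is_probability m -> 0 <= t ->
  is_probability (law_at jump_gen m t).
Proof.
move=> [m0 m1] t0; split; first by move=> x; exact: law_at_ge0.
have dS (s : R) : is_derive s 1 (fun s => \sum_y law_at jump_gen m s y) 0.
  have H := is_derive_sumf (fun y => is_derive_law_at m s y).
  by apply: (is_derive_eq H); rewrite sum_kernel_adj_jump.
rewrite (is_derive_0_is_cst t 0 dS) -m1.
by apply: eq_bigr => y _; rewrite law_at0.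
Qed.

(** At an empty state the diagonal entry is multiplied by zero, and only inflow remains. *)
Lemma kernel_adj_jump_ge0 m y : (forall x, 0 <= m x) -> m y = 0 ->
  0 <= kernel_adj jump_rate m y.
Proof.
move=> m0 my; apply: sumr_ge0 => x _.
have [->|xy] := eqVneq x y; first by rewrite my mul0r.
by rewrite mulr_ge0 // jump_rate_ge0.
Qed.

(* A vanishing mass with vanishing derivative is O(h^2): the first two
   coefficients of its (nonnegative) series vanish. *)
Lemma law_at_quadratic m y : (forall x, 0 <= m x) -> m y = 0 ->
  kernel_adj jump_rate m y = 0 ->
  exists C : R, forall h, 0 <= h <= 1 -> law_at jump_gen m h y <= C * h ^+ 2.
Proof.
move=> m0 my dmy.
pose b k := iter k (kernel_adj shifted_rate) m y.
exists (egf b 1) => h /andP[h0 h1]; rewrite law_at_egf -/b.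
have bb : geom_bounded b by exact: kernel_adj_geom.
have b_ge0 k : 0 <= b k by exact: iter_shifted_ge0.
have rs0 : 0 <= rate_sum by apply: sumr_ge0 => *; exact: sumr_ge0.
have b0 : b 0%N = 0 by [].
have b1 : b 1%N = 0.
  rewrite /b /= /kernel_adj /shifted_rate.
  under eq_bigr do rewrite mulrDr.
  rewrite big_split /= -/(kernel_adj jump_rate m y) dmy add0r big1 // => x _.
  by have [->|] := eqVneq x y; rewrite ?my ?mul0r ?mulr0.
have cv s : cvgn (series (fun k : nat => s ^+ k / k`!%:R * b k)) by exact: is_cvg_egf.
(* Since the first two coefficients vanish and [0 <= h <= 1], each term of the series at [h] is at
   most [h ^+ 2] times the corresponding term at 1. *)
have H : egf b h <= h ^+ 2 * egf b 1.
  have E2 : series (fun k : nat => h ^+ 2 * (1 ^+ k / k`!%:R * b k))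
      = (fun N => h ^+ 2 * series (fun k : nat => 1 ^+ k / k`!%:R * b k) N).
    by apply/funext => k; rewrite /series /= mulr_sumr.
  have C2 : series (fun k : nat => h ^+ 2 * (1 ^+ k / k`!%:R * b k)) @ \oo -->
      h ^+ 2 * egf b 1.
    by rewrite E2; apply: cvgM; [exact: cvg_cst|exact: cv].
  rewrite -(cvg_lim _ C2) // /egf.
  apply: lim_series_le => //.
    exact: cvgP C2.
  case=> [|[|k]]; rewrite ?b0 ?b1 ?mulr0 //.
  rewrite expr1n mulrA ler_wpM2r // mulrA mulr1 ler_wpM2r // !exprS expr0 mulr1 mulrA.
  by rewrite ler_piMr ?mulr_ge0 // exprn_ile1.
rewrite mulrC [leRHS]mulrC; apply: le_trans H.
rewrite ler_piMr ?expR_le1 ?oppr_le0 ?mulr_ge0 //.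
apply: le_trans (@egf_ge_term _ _ h 0%N bb _ h0) => //.
by rewrite expr0 fact0 divr1 mul1r.
Qed.

End JumpChain.

(** * Derivative of the relative entropy *)

Section EntropyDerivative.
Variable R : realType.
Implicit Types (f : R -> R) (t a c : R).

Lemma is_derive_right_quotient f a : is_derive (0 : R) 1 f a ->
  (f h - f 0) / h @[h --> 0^'+] --> a.
Proof.
move=> [df <-]; apply: cvg_dnbhs_at_right.
have -> : (fun h => (f h - f 0) / h) =
    (fun h => h^-1 *: (f (h *: 1 + 0) - f 0)).
  by apply/funext => h; rewrite /GRing.scale /= mulr1 addr0 mulrC.
exact: df.
Qed.

Lemma is_derive_entropy_term f t a c : is_derive t 1 f a -> 0 < f t -> 0 < c ->
  is_derive t 1 (fun s => f s * ln (f s / c)) (a * ln (f t / c) + a).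
Proof.
move=> df ft c0.
have d1 : is_derive t 1 (fun s => f s / c) (a / c).
  have -> : (fun s => f s / c) = c^-1 \*: f.
    by apply/funext => s /=; rewrite /GRing.scale /= mulrC.
  by apply: is_derive_eq; rewrite /GRing.scale /= mulrC.
have fc : 0 < f t / c by rewrite divr_gt0.
have d2 : is_derive t 1 (fun s => ln (f s / c)) ((f t / c)^-1 * (a / c)).
  exact: (@is_derive1_comp R (@ln R) (fun s => f s / c) _ _ _ (is_derive1_ln fc) d1).
apply: (is_derive_eq (is_deriveM df d2)); rewrite /GRing.scale /= addrC.
congr (_ + _); first by rewrite mulrC.
by field; rewrite !gt_eqF.
Qed.

(** With [x = s ^+ 4] one has |ln x| = 4 |ln s| <= 4 / s, hence the exponent 3/4 on the right. Being
    larger than 1/2, it turns a mass of order [h ^+ 2] into a term of order o(h). *)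
Lemma entropy_term_small (x c : R) : 0 < c -> 0 <= x <= 1 ->
  `|x * ln (x / c)| <= (4 + `|ln c|) * Num.sqrt x * Num.sqrt (Num.sqrt x).
Proof.
move=> c0 /andP[x0 x1].
have [->|xn0] := eqVneq x 0; first by rewrite mul0r normr0 sqrtr0 mulr0 mul0r.
have xp : 0 < x by rewrite lt_neqAle eq_sym xn0.
set s := Num.sqrt (Num.sqrt x).
have sp : 0 < s by rewrite !sqrtr_gt0.
have s2 : Num.sqrt x = s ^+ 2 by rewrite sqr_sqrtr ?sqrtr_ge0.
have s4 : x = s ^+ 4 by rewrite (exprM s 2 2) -s2 sqr_sqrtr.
have s1 : s <= 1 by rewrite -sqrtr1 ler_sqrt // -sqrtr1 ler_sqrt.
have lnx : `|ln x| <= 4 / s.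
  rewrite ler0_norm; last exact: ln_le0.
  rewrite s4 lnXn // -mulNrn -lnV ?posrE // -[_ *+ 4]mulr_natl ler_wpM2l //.
  by apply/ltW/ln_sublinear; rewrite invr_gt0.
rewrite ln_div ?posrE // normrM (ger0_norm x0).
apply: (@le_trans _ _ (x * (4 / s + `|ln c|))).
  by rewrite ler_wpM2l //; apply: le_trans (ler_normB _ _) _; rewrite lerD2r.
rewrite s2 [in leLHS]s4.
have -> : s ^+ 4 * (4 / s + `|ln c|) = s ^+ 3 * (4 + s * `|ln c|).
  by field; rewrite gt_eqF.
rewrite [leRHS](_ : _ = s ^+ 3 * (4 + `|ln c|)); last by ring.
rewrite ler_wpM2l ?exprn_ge0 ?(ltW sp) // lerD2l ler_piMl //.
Qed.

Lemma entropy_quotient_cvg0 f c (C : R) : 0 < c ->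
  f h @[h --> 0^'+] --> 0 ->
  (\forall h \near 0^'+, 0 <= f h <= C * h ^+ 2) ->
  f h * ln (f h / c) / h @[h --> 0^'+] --> 0.
Proof.
move=> c0 fh0 fhC.
pose g h := (4 + `|ln c|) * Num.sqrt C * Num.sqrt (Num.sqrt (f h)).
have g0 : g h @[h --> 0^'+] --> 0.
  rewrite -[X in _ --> X](mulr0 ((4 + `|ln c|) * Num.sqrt C)).
  apply: cvgM; first exact: cvg_cst.
  have sq0 : Num.sqrt h @[h --> (0 : R)] --> (0 : R).
    by have := @sqrt_continuous R 0; rewrite /continuous_at sqrtr0.
  apply: (@cvg_comp _ _ _ (fun h => Num.sqrt (f h)) _ _ (nbhs (0:R))); last exact: sq0.
  by apply: (@cvg_comp _ _ _ f _ _ (nbhs (0:R))) => //; exact: sq0.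
apply: (@squeeze_cvgr _ _ _ _ (fun h => - g h) g) => //; last first.
  by have := cvgN g0; rewrite oppr0; exact.
have f1 : \forall h \near 0^'+, f h < 1.
  by apply: (cvgr_lt 0).
near=> h.
have h0 : 0 < h by near: h; exact: nbhs_right_gt.
have /andP[fh_ge0 fhle] : 0 <= f h <= C * h ^+ 2 by near: h.
have fh1 : f h < 1 by near: h.
have C0 : 0 <= C.
  by have := le_trans fh_ge0 fhle; rewrite pmulr_lge0 ?exprn_gt0.
rewrite -ler_norml normrM normfV (ger0_norm (ltW h0)) ler_pdivrMr //.
apply: le_trans (entropy_term_small c0 _) _; first by rewrite fh_ge0 ltW.
rewrite /g -!mulrA ler_wpM2l ?addr_ge0 // [leRHS]mulrA [leRHS]mulrAC ler_wpM2r ?sqrtr_ge0 //.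
rewrite -[X in _ <= _ * X](ger0_norm (ltW h0)) -sqrtr_sqr -sqrtrM //.
by rewrite ler_wsqrtr.
Unshelve. all: by end_near. Qed.

(** The case of a state that starts empty and fills at rate [a]: the factor [f h / h] stays above
    [a / 2] while the logarithm tends to minus infinity. *)
Lemma entropy_quotient_cvgNy f c a : 0 < c -> 0 < a ->
  f h / h @[h --> 0^'+] --> a -> f h @[h --> 0^'+] --> 0 ->
  (f h * ln (f h / c) / h)%:E @[h --> 0^'+] --> -oo%E.
Proof.
move=> c0 a0 fa f0; apply/cvgeNyPle => A.
have fa2 : \forall h \near 0^'+, a / 2 < f h / h.
  by apply: (cvgr_gt a) => //; rewrite ltr_pdivrMr // ltr_pMr // ltr1n.
(* Below the threshold [A'] the logarithm is so negative that its product with [a / 2] is at most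
   -|A|. *)
pose A' := expR (- (`|A| / (a / 2))) * c.
have A'0 : 0 < A' by rewrite mulr_gt0 // expR_gt0.
have fA : \forall h \near 0^'+, f h < A' by apply: (cvgr_lt 0).
near=> h.
have h0 : 0 < h by near: h; exact: nbhs_right_gt.
have a2 : 0 < a / 2 by rewrite divr_gt0.
have q : a / 2 < f h / h by near: h.
have fp : 0 < f h by rewrite -(pmulr_lgt0 _ (_ : 0 < h^-1)) ?invr_gt0 // (lt_trans a2).
have lnle : ln (f h / c) <= - (`|A| / (a / 2)).
  rewrite -[leRHS]expRK ler_ln ?posrE ?expR_gt0 ?divr_gt0 // ler_pdivrMr //.
  by apply: ltW; near: h.
rewrite lee_fin mulrAC.
apply: (@le_trans _ _ (- `|A|)); last by rewrite lerNl -normrN ler_norm.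
have ln0 : ln (f h / c) <= 0.
  by apply: le_trans lnle _; rewrite oppr_le0 divr_ge0 // ltW.
apply: (@le_trans _ _ (a / 2 * ln (f h / c))).
  by rewrite ler_wnM2r // ltW.
apply: (@le_trans _ _ (a / 2 * (- (`|A| / (a / 2))))); first by rewrite ler_wpM2l // ltW.
by rewrite mulrN mulrCA divff ?mulr1 // gt_eqF.
Unshelve. all: by end_near. Qed.

(** Excluding [+oo] as a limit rules out sums of opposite infinities, whereas [-oo] stays
    allowed. *)
Lemma cvge_sum_lty (I : finType) (u : I -> R -> \bar R) (l : I -> \bar R)
    (F : set_system R) {FF : Filter F} :
  (forall i, l i != +oo%E) -> (forall i, u i h @[h --> F] --> l i) ->
  (\sum_i u i h)%E @[h --> F] --> (\sum_i l i)%E.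
Proof.
move=> ly H; elim: (index_enum I) => [|i s IH].
  under eq_cvg do rewrite big_nil; rewrite big_nil.
  exact: (@cvg_cst _ 0%E).
under eq_cvg do rewrite big_cons; rewrite big_cons.
apply: cvgeD => //; apply: ltpinfty_adde_def; rewrite inE ?ltey //.
by rewrite -ltey; apply: lte_sum_pinfty => j _; rewrite ltey.
Qed.

End EntropyDerivative.

(** * Entropy production and Dirichlet form *)

Section EntropyProduction.
Variables (R : realType) (d n : nat) (B : finType).
Variables (r : B -> Omega d n -> R) (T : B -> Omega d n -> Omega d n).
Hypothesis r_ge0 : forall b x, 0 <= r b x.
Variable nu : Omega d n -> R.
Hypothesis nu_gt0 : forall x, 0 < nu x.
Implicit Types (x y : Omega d n) (m : Omega d n -> R) (t : R).

Let q := jump_rate r T.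
Let law m t := law_at (jump_gen r T) m t.

(** The formal time derivative of the relative entropy at [m]; the other term of the product rule
    sums to zero by conservation of mass. Empty states contribute nothing because [ln 0 = 0]. *)
Definition entropy_production m : R :=
  \sum_x kernel_adj q m x * ln (m x / nu x).

Lemma entropy_production_sum m :
  \sum_x (kernel_adj q m x * ln (m x / nu x) + kernel_adj q m x) =
  entropy_production m.
Proof. by rewrite big_split /= sum_kernel_adj_jump addr0. Qed.

(** By [law_at_eq0_or_gt0] a state is either empty at all times, with zero derivative, or has
    positive mass at [t], where its entropy term is differentiable. *)
Lemma entropy_is_derive m t : is_probability m -> 0 < t ->
  (forall x, law m t x = 0 -> kernel_adj q (law m t) x = 0) /\
  is_derive t 1 (fun s => relative_entropy (law m s) nu)
    (entropy_production (law m t)).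
Proof.
move=> [m0 m1] t0.
have K0 x : law m t x = 0 -> kernel_adj q (law m t) x = 0.
  move=> l0; have [H|H] := law_at_eq0_or_gt0 T r_ge0 x m0; last first.
    by have := H t t0; rewrite -/(law m t x) l0 ltxx.
  have D : is_derive t 1 (fun s => law m s x) (kernel_adj q (law m t) x).
    exact: is_derive_law_at.
  rewrite -(@derive_val _ _ _ _ _ _ _ D).
  have -> : (fun s => law m s x) = cst 0 by apply/funext => s; exact: H.
  by rewrite derive_cst.
split=> //; rewrite -entropy_production_sum /relative_entropy.
apply: is_derive_sumf => x.
have [H|H] := law_at_eq0_or_gt0 T r_ge0 x m0.
  rewrite (K0 _ (H t)) mul0r add0r.
  have -> : (fun s => law m s x * ln (law m s x / nu x)) = cst 0.
    by apply/funext => s; rewrite [law m s x]H mul0r.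
  exact: is_derive_cst.
by apply: is_derive_entropy_term => //; [exact: is_derive_law_at|exact: H].
Qed.

(** There are three kinds of states at time 0: those with mass, where the product rule applies;
    empty ones with positive inflow, each contributing [-oo]; empty ones without inflow, whose mass
    is O(h^2) and whose contribution vanishes. *)
Lemma entropy_right_derivative m : is_probability m ->
  exists2 l : \bar R,
    ((relative_entropy (law m h) nu - relative_entropy (law m 0) nu) / h)%:E
      @[h --> 0^'+] --> l &
    l = -oo%E \/ (forall x, m x = 0 -> kernel_adj q m x = 0) /\
                 l = (entropy_production m)%:E.
Proof.
move=> [m0 m1].
have L0 : law m 0 = m by exact: law_at0.
have D x : is_derive (0 : R) 1 (fun s => law m s x) (kernel_adj q m x).
  by have := is_derive_law_at r T m 0 x; rewrite -/(law m 0) L0.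
have Lc x : m x = 0 -> law m h x @[h --> 0^'+] --> 0.
  move=> mx; apply: cvg_at_right_filter.
  have dl : differentiable (fun s => law m s x) (0 : R).
    by apply/derivable1_diffP; exact: ex_derive.
  have H : law m h x @[h --> (0 : R)] --> law m 0 x.
    exact: (differentiable_continuous dl).
  by rewrite L0 mx in H.
pose l x : \bar R := if (m x == 0) && (kernel_adj q m x != 0) then -oo%E
  else (kernel_adj q m x * ln (m x / nu x) + kernel_adj q m x)%:E.
pose g x h : R := (law m h x * ln (law m h x / nu x)
                   - law m 0 x * ln (law m 0 x / nu x)) / h.
have gl x : (g x h)%:E @[h --> 0^'+] --> l x.
  rewrite /g /l; have [mx|mx] /= := eqVneq (m x) 0; last first.
    apply: cvg_EFin; first by near=> h.
    have := is_derive_entropy_term (D x) _ (nu_gt0 x).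
    rewrite L0 lt_neqAle eq_sym mx m0 => /(_ isT) /is_derive_right_quotient.
    by rewrite L0.
  have -> : (fun h => ((law m h x * ln (law m h x / nu x) -
        law m 0 x * ln (law m 0 x / nu x)) / h)%:E) =
      (fun h => (law m h x * ln (law m h x / nu x) / h)%:E).
    by apply/funext => h; rewrite L0 mx mul0r subr0.
  have Q : law m h x / h @[h --> 0^'+] --> kernel_adj q m x.
    have := is_derive_right_quotient (D x).
    by under eq_cvg do rewrite L0 mx subr0.
  have [kx|kx] /= := eqVneq (kernel_adj q m x) 0; last first.
    apply: (entropy_quotient_cvgNy (f := fun h => law m h x) (nu_gt0 x) _ Q (Lc x mx)).
    by rewrite lt_neqAle eq_sym kx kernel_adj_jump_ge0.
  rewrite kx mul0r addr0; apply: cvg_EFin; first by near=> h.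
  have [C HC] := law_at_quadratic r_ge0 m0 mx kx.
  apply: (entropy_quotient_cvg0 (f := fun h => law m h x) (C := C) (nu_gt0 x) (Lc x mx)).
  near=> h.
  have h0 : 0 < h by near: h; exact: nbhs_right_gt.
  have h1 : h <= 1 by near: h; exact: nbhs_right_le.
  apply/andP; split; last by apply: HC; rewrite h1 ltW.
  by apply: law_at_ge0 => //; rewrite ltW.
exists (\sum_x l x)%E.
  have -> : (fun h => ((relative_entropy (law m h) nu -
        relative_entropy (law m 0) nu) / h)%:E) = (fun h => (\sum_x (g x h)%:E)%E).
    apply/funext => h; rewrite sumEFin; congr _%:E.
    by rewrite /relative_entropy /g -mulr_suml sumrB.
  by apply: cvge_sum_lty => // x; rewrite /l; case: ifP.
have [/existsP[x /andP[mx kx]]|] :=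
    boolP [exists x, (m x == 0) && (kernel_adj q m x != 0)].
  left; apply/eqP; rewrite esum_eqNy; apply/existsP; exists x.
  by rewrite /l mx kx.
rewrite negb_exists => /forallP H; right; split.
  by move=> x mx; have := H x; rewrite mx eqxx /= negbK => /eqP.
rewrite -entropy_production_sum -sumEFin; apply: eq_bigr => x _.
by rewrite /l (negbTE (H x)).
Unshelve. all: by end_near. Qed.

Lemma ln_le_sqrt (x : R) : 0 < x -> ln x <= 2 * (Num.sqrt x - 1).
Proof.
move=> x0; have s0 : 0 < Num.sqrt x by rewrite sqrtr_gt0.
rewrite -[x in leLHS](sqr_sqrtr (ltW x0)) lnXn // -[leLHS]mulr_natl ler_wpM2l //.
have := @le_ln1Dx R (Num.sqrt x - 1); rewrite addrCA subrr addr0; apply.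
by rewrite ltrBrDr addrC subrr.
Qed.

(** Let u and v be the square roots of [f x] and [f (T b x)]. Then [ln_le_sqrt] bounds u^2 ln (v^2 /
    u^2) by 2 u (v - u) = v^2 - u^2 - (v - u)^2: a part linear in [f], which yields the adjoint of
    the generator applied to 1, and the Dirichlet form. *)
Lemma entropy_production_le m (f := fun x => m x / nu x) :
  (forall x, 0 <= m x) ->
  (forall x, m x = 0 -> kernel_adj q m x = 0) ->
  entropy_production m <=
  \sum_b \sum_x nu x * r b x *
    (f (T b x) - f x - (Num.sqrt (f (T b x)) - Num.sqrt (f x)) ^+ 2).
Proof.
move=> m0 mk; rewrite /entropy_production kernel_adjE -jump_genE /jump_gen.
under eq_bigr do rewrite mulr_sumr.
rewrite exchange_big /=; apply: ler_sum => b _; apply: ler_sum => x _.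
have f0 y : 0 <= f y by rewrite divr_ge0 // ltW.
have mE y : m y = nu y * f y by rewrite mulrC divfK // gt_eqF.
have [mx|mx] := eqVneq (m x) 0.
  have fx : f x = 0 by rewrite /f mx mul0r.
  by rewrite mx mul0r fx sqrtr0 !subr0 sqr_sqrtr // subrr mulr0.
have [rx|rx] := eqVneq (r b x) 0; first by rewrite rx !(mulr0, mul0r).
have mx0 : 0 < m x by rewrite lt_neqAle eq_sym mx m0.
have fx0 : 0 < f x by rewrite divr_gt0.
(* mass cannot jump off the support, for the outside derivative vanishes *)
have fT0 : 0 < f (T b x).
  rewrite divr_gt0 // lt_neqAle eq_sym m0 andbT; apply/eqP => mT.
  have xT : x != T b x by apply: contraNneq mx => ->; rewrite mT.
  have := mk _ mT; rewrite /kernel_adj => /eqP.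
  rewrite psumr_eq0; last first.
    move=> z _; have [->|zT] := eqVneq z (T b x); first by rewrite mT mul0r.
    by rewrite mulr_ge0 // jump_rate_ge0.
  move=> /allP /(_ x (mem_index_enum _)) /=; rewrite mulf_eq0 (negbTE mx) /=.
  rewrite /q /jump_rate psumr_eq0; last first.
    by move=> b' _; rewrite (negbTE xT) subr0 mulr_ge0.
  move=> /allP /(_ b (mem_index_enum _)) /=.
  by rewrite eqxx (negbTE xT) subr0 mulr1 (negbTE rx).
have -> : ln (m (T b x) / nu (T b x)) - ln (m x / nu x) = ln (f (T b x) / f x).
  by rewrite [RHS]ln_div ?posrE.
rewrite mE -[nu x * f x * _]mulrA -[nu x * r b x * _]mulrA.
apply: ler_wpM2l; first exact: ltW.
rewrite mulrCA; apply: ler_wpM2l => //.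
apply: (@le_trans _ _ (f x * (2 * (Num.sqrt (f (T b x) / f x) - 1)))).
  by apply: ler_wpM2l => //; rewrite ln_le_sqrt // divr_gt0.
rewrite (sqrtrM _ (ltW fT0)) (sqrtrV (ltW fx0)).
have := sqr_sqrtr (ltW fx0); have := sqr_sqrtr (ltW fT0).
have : 0 < Num.sqrt (f x) by rewrite sqrtr_gt0.
set u := Num.sqrt (f x); set v := Num.sqrt _ => u0 <- <-.
rewrite [leLHS](_ : _ = v ^+ 2 - u ^+ 2 - (v - u) ^+ 2) //.
by field; rewrite gt_eqF.
Qed.

End EntropyProduction.

(** * Sequential prediction of a product measure *)

Section Prediction.
Variables (R : realType) (I : finType) (rho : R).
Hypotheses (rho_gt0 : 0 < rho) (rho_lt1 : rho < 1).
Implicit Types (x y z : {ffun I -> bool}) (i j k : I) (s : seq I).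

Definition centered i x : R := (x i)%:R - rho.

Let w01 (b : bool) : R := if b then rho else 1 - rho.

Let w01_gt0 b : 0 < w01 b.
Proof. by case: b; rewrite /w01 // subr_gt0. Qed.

(** Pinsker's inequality for one bit, via the Hellinger distance: [D] bounds each term below by a
    linear part plus a squared difference of roots, the linear parts of the two outcomes cancel, and
    [S] compares roots with values on [0, 1]. *)
Lemma binary_divergence_ge (p : R) : 0 <= p <= 1 ->
  2^-1 * (p - rho) ^+ 2 <=
  p * ln (p / rho) + (1 - p) * ln ((1 - p) / (1 - rho)).
Proof.
have D (a b : R) : 0 <= a -> 0 < b ->
    a - b + (Num.sqrt a - Num.sqrt b) ^+ 2 <= a * ln (a / b).
  move=> a0 b0; have sb := sqr_sqrtr (ltW b0).
  have [->|an0] := eqVneq a 0; first by rewrite sqrtr0 !sub0r sqrrN sb addNr mul0r.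
  have ap : 0 < a by rewrite lt_neqAle eq_sym an0.
  have sa := sqr_sqrtr a0; have sap : 0 < Num.sqrt a by rewrite sqrtr_gt0.
  have -> : ln (a / b) = - ln (b / a) by rewrite -lnV ?posrE ?divr_gt0 // invf_div.
  rewrite mulrN lerNr; have := ln_le_sqrt (divr_gt0 b0 ap).
  move=> /(ler_wpM2l a0) H; apply: le_trans H _.
  rewrite (sqrtrM _ (ltW b0)) (sqrtrV a0) -[X in X * _]sa -[X in X - b]sa -[X in _ - X + _]sb.
  rewrite [leLHS](_ : _ = 2 * (Num.sqrt b - Num.sqrt a) * Num.sqrt a); last first.
    by field; rewrite gt_eqF.
  by rewrite [leLHS](_ : _ = - (Num.sqrt a ^+ 2 - Num.sqrt b ^+ 2 + (Num.sqrt a - Num.sqrt b) ^+ 2)) //; ring.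
have S (a b : R) : 0 <= a <= 1 -> 0 <= b <= 1 ->
    (a - b) ^+ 2 <= 4 * (Num.sqrt a - Num.sqrt b) ^+ 2.
  move=> /andP[a0 a1] /andP[b0 b1].
  rewrite -{1}(sqr_sqrtr a0) -{1}(sqr_sqrtr b0) subr_sqr exprMn mulrC.
  rewrite ler_wpM2r ?sqr_ge0 //.
  have -> : 4 = 2 ^+ 2 :> R by rewrite -natrX.
  rewrite ler_sqr ?nnegrE ?addr_ge0 ?sqrtr_ge0 // (_ : 2 = 1 + 1 :> R) // lerD //.
    by rewrite -sqrtr1 ler_wsqrtr.
  by rewrite -sqrtr1 ler_wsqrtr.
move=> /andP[p0 p1].
have h1 := D p rho p0 rho_gt0.
have h2 : _ <= (1 - p) * ln ((1 - p) / (1 - rho)) := D (1 - p) (1 - rho) _ _.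
have {}h2 := h2 _ _; rewrite subr_ge0 subr_gt0 in h2; have {}h2 := h2 p1 rho_lt1.
have s1 : (p - rho) ^+ 2 <= 4 * (Num.sqrt p - Num.sqrt rho) ^+ 2.
  by apply: S; rewrite ?p0 ?p1 // !ltW.
have s2 : (1 - p - (1 - rho)) ^+ 2 <= 4 * (Num.sqrt (1 - p) - Num.sqrt (1 - rho)) ^+ 2.
  by apply: S; rewrite ?subr_ge0 ?gerBl ?p0 ?p1 ?(ltW rho_lt1) ?(ltW rho_gt0).
have s3 : (1 - p - (1 - rho)) ^+ 2 = (p - rho) ^+ 2 by ring.
rewrite s3 in s2; lra.
Qed.

Variable m : {ffun I -> bool} -> R.
Hypotheses (m_ge0 : forall x, 0 <= m x) (m_sum1 : \sum_x m x = 1).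

Definition agree s x y := all (fun i => x i == y i) s.

(** The law of the sites in [s], kept as a function of the whole configuration so that no type of
    partial configurations is introduced. *)
Definition marginal s x : R := \sum_(y | agree s x y) m y.

(** On a class of zero mass the quotient is 0 by the convention for division; such configurations
    have no weight under [m]. *)
Definition cond_prob s i x : R :=
  (\sum_(y | agree s x y) m y * (y i)%:R) / marginal s x.

(** For duplicate-free [s], the relative entropy of the law of the sites in [s] with respect to the
    Bernoulli law: the logarithm depends on these sites only. *)
Definition marginal_entropy s : R :=
  \sum_x m x * ln (marginal s x / \prod_(i <- s) w01 (x i)).

Lemma agreexx s x : agree s x x.
Proof. by apply/allP. Qed.

Lemma agree_sym s x y : agree s x y = agree s y x.
Proof. by apply: eq_all => i; rewrite eq_sym. Qed.

Lemma agree_eq s x y z : agree s x y -> agree s x z = agree s y z.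
Proof.
move=> /allP xy; apply: eq_in_all => i si.
by have /eqP -> := xy i si.
Qed.

Lemma marginal_agree s x y : agree s x y -> marginal s x = marginal s y.
Proof. by move=> xy; apply: eq_bigl => z; rewrite (agree_eq _ xy). Qed.

Lemma cond_prob_agree s i x y : agree s x y -> cond_prob s i x = cond_prob s i y.
Proof.
move=> xy; rewrite /cond_prob (marginal_agree xy); congr (_ / _).
by apply: eq_bigl => z; rewrite (agree_eq _ xy).
Qed.

Lemma marginal_ge s x : m x <= marginal s x.
Proof. by rewrite /marginal (bigD1 x) ?agreexx //= lerDl sumr_ge0. Qed.

Lemma cond_prob01 s i x : 0 <= cond_prob s i x <= 1.
Proof.
have M0 : 0 <= marginal s x by apply: sumr_ge0.
apply/andP; split.
  by rewrite divr_ge0 // sumr_ge0 // => y _; rewrite mulr_ge0.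
have [Mx|Mn0] := eqVneq (marginal s x) 0.
  by rewrite /cond_prob Mx invr0 mulr0.
rewrite /cond_prob ler_pdivrMr ?lt_neqAle ?(eq_sym 0) ?Mn0 // mul1r.
by apply: ler_sum => y _; rewrite ler_piMr // lern1 leq_b1.
Qed.

(** Expand the conditional mean and exchange the two sums: [agree s] is symmetric, and [g] and the
    marginal are constant on its classes. *)
Lemma cond_prob_tower s i (g : {ffun I -> bool} -> R) :
  (forall x y, agree s x y -> g x = g y) ->
  \sum_x m x * (g x * cond_prob s i x) = \sum_x m x * (g x * (x i)%:R).
Proof.
move=> gs; transitivity
  (\sum_x \sum_(y | agree s x y) m x * (g y * (m y * (y i)%:R) / marginal s y)).
  apply: eq_bigr => x _; rewrite /cond_prob mulr_suml !mulr_sumr.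
  apply: eq_bigr => y xy; rewrite (marginal_agree xy) (gs _ _ xy).
  by rewrite !mulrA.
rewrite (exchange_big_dep predT) //=; apply: eq_bigr => y _.
rewrite -mulr_suml.
have -> : \sum_(x | agree s x y) m x = marginal s y.
  by apply: eq_bigl => x; rewrite agree_sym.
(* If the class of [y] has zero mass then so has [y], and both sides vanish. *)
have [M0|Mn0] := eqVneq (marginal s y) 0; last first.
  by rewrite mulrC divfK // mulrCA.
have -> : m y = 0.
  by apply/eqP; rewrite eq_le m_ge0 andbT -M0 marginal_ge.
by rewrite M0 !mul0r.
Qed.

Lemma marginal_cons s i x : marginal s x != 0 ->
  marginal (i :: s) x =
  marginal s x * (if x i then cond_prob s i x else 1 - cond_prob s i x).
Proof.
move=> Mn0.
have E : marginal s x * cond_prob s i x = \sum_(y | agree s x y) m y * (y i)%:R.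
  by rewrite mulrC divfK.
case xi: (x i).
  rewrite E /marginal big_mkcond [RHS]big_mkcond; apply: eq_bigr => y _ /=.
  by rewrite xi; case: (y i) => /=; case: ifP; rewrite ?mulr1 ?mulr0.
rewrite mulrBr mulr1 E /marginal -sumrB big_mkcond [RHS]big_mkcond.
apply: eq_bigr => y _ /=; rewrite xi.
by case: (y i) => /=; case: ifP; rewrite ?mulr1 ?mulr0 ?subrr ?subr0.
Qed.

(** The chain rule: revealing [i] adds the mean divergence of its conditional law from the Bernoulli
    law, which [binary_divergence_ge] bounds below. *)
Lemma marginal_entropy_cons s i :
  marginal_entropy s + 2^-1 * \sum_x m x * (cond_prob s i x - rho) ^+ 2 <=
  marginal_entropy (i :: s).
Proof.
pose p x := cond_prob s i x.
pose l1 x := ln (p x / rho); pose l0 x := ln ((1 - p x) / (1 - rho)).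
have pe x y : agree s x y -> p x = p y by exact: cond_prob_agree.
have -> : marginal_entropy (i :: s) = marginal_entropy s +
    \sum_x m x * (l0 x + (l1 x - l0 x) * (x i)%:R).
  rewrite -big_split /=; apply: eq_bigr => x _.
  have [->|mx] := eqVneq (m x) 0; first by rewrite !mul0r addr0.
  have mx0 : 0 < m x by rewrite lt_neqAle eq_sym mx m_ge0.
  rewrite -mulrDr; congr (_ * _).
  have Ms : 0 < marginal s x by apply: lt_le_trans (marginal_ge _ _).
  have Mis : 0 < marginal (i :: s) x by apply: lt_le_trans (marginal_ge _ _).
  have N0 : 0 < \prod_(j <- s) w01 (x j) by apply: prodr_gt0.
  rewrite big_cons; rewrite marginal_cons ?gt_eqF // in Mis *.
  rewrite pmulr_rgt0 // in Mis.
  rewrite [X in ln X](_ : _ = marginal s x / \prod_(j <- s) w01 (x j) *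
     ((if x i then p x else 1 - p x) / w01 (x i))); last first.
    by rewrite invfM [_^-1 * _^-1]mulrC mulrACA.
  rewrite lnM ?posrE ?divr_gt0 //; congr (_ + _).
  by rewrite /l1 /l0 /w01; case: (x i); rewrite ?mulr1 ?mulr0 ?addr0 // addrC subrK.
rewrite lerD2l.
(* The logarithms depend only on the sites already revealed, so the value at [i] may be replaced by
   its conditional mean. *)
have -> : \sum_x m x * (l0 x + (l1 x - l0 x) * (x i)%:R) =
    \sum_x m x * (p x * l1 x + (1 - p x) * l0 x).
  under eq_bigr do rewrite mulrDr; rewrite big_split /=.
  rewrite -(cond_prob_tower (s := s)); last first.
    by move=> x y xy; rewrite /l1 /l0 (pe _ _ xy).
  by rewrite -big_split /=; apply: eq_bigr => x _; rewrite -/(p x); ring.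
rewrite mulr_sumr; apply: ler_sum => x _.
by rewrite mulrCA ler_wpM2l // binary_divergence_ge // cond_prob01.
Qed.

(* The sites of [s] are revealed from the tail to the head: the prediction of a
   site is its conditional mean given the sites after it in [s]. *)
Fixpoint prediction s i x : R :=
  if s is j :: s' then
    if i == j then cond_prob s' i x - rho else prediction s' i x
  else 0.

Lemma prediction_agree s i x y : agree s x y -> prediction s i x = prediction s i y.
Proof.
elim: s => [|j s IH] //= /andP[_ xy].
by case: eqP => _; rewrite ?(cond_prob_agree _ xy) ?IH.
Qed.

Lemma prediction_error s i x : i \in s ->
  `|centered i x - prediction s i x| <= 1.
Proof.
elim: s => [|j s IH] //=; rewrite inE; case: eqP => [_ _|_] /=; last exact: IH.
rewrite /centered opprB addrA subrK.
have := cond_prob01 s i x; case: (x i) => /=; rewrite ler_norml; lra.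
Qed.

(** Add up [marginal_entropy_cons] over the sites; a new head leaves the predictions at the sites of
    the tail unchanged, since it does not occur there. *)
Lemma prediction_entropy s : uniq s ->
  \sum_x m x * \sum_(i <- s) prediction s i x ^+ 2 <= 2 * marginal_entropy s.
Proof.
elim: s => [|j s IH] /=.
  move=> _; rewrite /marginal_entropy.
  rewrite [X in _ <= 2 * X]big1 ?mulr0; last first.
    by move=> x _; rewrite /marginal /= m_sum1 big_nil divr1 ln1 mulr0.
  by rewrite big1 // => x _; rewrite big_nil mulr0.
move=> /andP[js us]; have := marginal_entropy_cons s j; have := IH us.
under [X in _ -> _ -> X <= _]eq_bigr => x _.
  rewrite big_cons eqxx mulrDr.
  have -> : \sum_(i <- s) (if i == j then cond_prob s i x - rho else
      prediction s i x) ^+ 2 = \sum_(i <- s) prediction s i x ^+ 2.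
    apply: eq_big_seq => i si; case: eqP => // ij.
    by move: js; rewrite -ij si.
  over.
rewrite big_split /=; lra.
Qed.

(** The errors are martingale differences: of two sites, the error at the one revealed first is a
    function of the past of the other, whose error has conditional mean zero. *)
Lemma prediction_orthogonal s i j : uniq s -> i \in s -> j \in s -> i != j ->
  \sum_x m x * ((centered i x - prediction s i x) *
                (centered j x - prediction s j x)) = 0.
Proof.
have main k s' l : l \in s' -> k \notin s' ->
    \sum_x m x * ((centered l x - prediction s' l x) *
                  (centered k x - (cond_prob s' k x - rho))) = 0.
  move=> ls ks; pose g x := centered l x - prediction s' l x.
  have gs x y : agree s' x y -> g x = g y.
    move=> xy; rewrite /g (prediction_agree _ xy) /centered.
    by have /allP/(_ l ls)/eqP -> := xy.
  transitivity (\sum_x (m x * (g x * (x k)%:R) - m x * (g x * cond_prob s' k x))).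
    by apply: eq_bigr => x _; rewrite /g /centered; ring.
  by rewrite sumrB (cond_prob_tower _ gs) subrr.
elim: s => [|k s IH] //= /andP[ks us].
rewrite !inE; case: (eqVneq i k) => [->|ik] /=.
  case: (eqVneq j k) => [->|jk] /=; first by [].
  move=> _ js _; rewrite -[RHS](main k s j js ks).
  by apply: eq_bigr => x _; rewrite [X in _ * X]mulrC.
case: (eqVneq j k) => [->|jk] /= si sj ij; first exact: main.
exact: IH.
Qed.

(** Apply the previous lemmas to an enumeration of all sites, for which the marginal is [m]
    itself. *)
Lemma exists_prediction :
  exists p : I -> {ffun I -> bool} -> R,
  [/\ forall i x, `|centered i x - p i x| <= 1,
      \sum_x m x * \sum_i p i x ^+ 2 <=
        2 * \sum_x m x * ln (m x / \prod_i w01 (x i)) &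
      forall i j, i != j ->
        \sum_x m x * ((centered i x - p i x) * (centered j x - p j x)) = 0].
Proof.
exists (prediction (enum I)); split=> [i x||i j ij].
- by apply: prediction_error; rewrite mem_enum.
- have := prediction_entropy (enum_uniq I).
  rewrite /marginal_entropy.
  under [X in X <= _ -> _]eq_bigr do rewrite big_enum.
  under [X in _ <= 2 * X -> _]eq_bigr => x _.
    rewrite big_enum /=.
    have -> : marginal (enum I) x = m x.
      rewrite /marginal (big_pred1 x) // => y /=.
      apply/allP/eqP => [H|-> //]; apply/ffunP => i.
      by apply/esym/eqP/H; rewrite mem_enum.
    over.
  by [].
- by apply: prediction_orthogonal; rewrite ?mem_enum // enum_uniq.
Qed.

End Prediction.

(** * Quadratic forms in the centered configuration *)

Section Convolution.
Variables (R : realType) (V : finZmodType).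
Implicit Types (K u v : V -> R) (w y z : V).

(** The sign in [w + z] makes this an average of [u] as seen from [w]; the adjoint therefore
    involves the reflected kernel. *)
Definition conv K u w : R := \sum_z K z * u (w + z).

Lemma sum_shift (F : V -> R) w : \sum_z F (w + z) = \sum_z F z.
Proof.
rewrite [RHS](reindex_onto (fun z => w + z) (fun z => z - w)) /=; last first.
  by move=> z _; rewrite addrC subrK.
by apply: eq_bigl => z; rewrite addrC addKr eqxx.
Qed.

Lemma sum_opp (F : V -> R) : \sum_z F (- z) = \sum_z F z.
Proof.
rewrite [RHS](reindex_onto (fun z => - z) (fun z => - z)) /=; last first.
  by move=> z _; rewrite opprK.
by apply: eq_bigl => z; rewrite opprK eqxx.
Qed.

Lemma conv_adjoint K u v :
  \sum_w v w * conv K u w = \sum_w u w * conv (fun z => K (- z)) v w.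
Proof.
rewrite /conv; under eq_bigr do rewrite mulr_sumr.
under [RHS]eq_bigr do rewrite mulr_sumr.
rewrite exchange_big [RHS]exchange_big /=.
rewrite -[RHS]sum_opp; apply: eq_bigr => z _; rewrite opprK.
rewrite -[RHS](sum_shift _ z); apply: eq_bigr => w _.
by rewrite [z + w]addrC addrK mulrA mulrC [v w * _]mulrC.
Qed.

Lemma young_l2 K u : (forall z, 0 <= K z) ->
  \sum_w (conv K u w) ^+ 2 <= (\sum_z K z) ^+ 2 * \sum_w u w ^+ 2.
Proof.
move=> K0; set S := \sum_z K z.
(* Cauchy-Schwarz with weights [K], obtained by symmetrizing the double sum and using 2 a b <= a^2 +
   b^2 in each term. *)
have pt w : (conv K u w) ^+ 2 <= S * \sum_z K z * u (w + z) ^+ 2.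
  have E1 : S * (\sum_z K z * u (w + z) ^+ 2) =
      \sum_z \sum_y K z * K y * u (w + z) ^+ 2.
    rewrite mulrC mulr_suml; apply: eq_bigr => z _.
    by rewrite /S mulr_sumr; apply: eq_bigr => y _; ring.
  have E2 : S * (\sum_z K z * u (w + z) ^+ 2) =
      \sum_z \sum_y K z * K y * u (w + y) ^+ 2.
    rewrite E1 exchange_big; apply: eq_bigr => z _; apply: eq_bigr => y _; ring.
  have E : S * (\sum_z K z * u (w + z) ^+ 2) =
      \sum_z \sum_y 2^-1 * (K z * K y * (u (w + z) ^+ 2 + u (w + y) ^+ 2)).
    transitivity (2^-1 * (S * (\sum_z K z * u (w + z) ^+ 2)) +
                  2^-1 * (S * (\sum_z K z * u (w + z) ^+ 2))); first lra.
    rewrite {1}E1 E2 !mulr_sumr -big_split /=; apply: eq_bigr => z _.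
    rewrite !mulr_sumr -big_split /=; apply: eq_bigr => y _; ring.
  rewrite E expr2 /conv mulr_suml; apply: ler_sum => z _.
  rewrite mulr_sumr; apply: ler_sum => y _.
  rewrite mulrACA [leRHS]mulrCA ler_wpM2l ?mulr_ge0 //.
  have := sqr_ge0 (u (w + z) - u (w + y)); lra.
apply: (le_trans (ler_sum _ (fun w _ => pt w))).
rewrite -mulr_sumr exchange_big /= expr2 -mulrA ler_wpM2l ?sumr_ge0 //.
rewrite {1}/S mulr_suml; apply: ler_sum => z _.
rewrite -mulr_sumr -[X in _ <= _ * X](sum_shift (fun w => u w ^+ 2) z).
by rewrite (eq_bigr (fun w => u (z + w) ^+ 2)) // => w _; rewrite addrC.
Qed.

Variable rho : R.
Hypotheses (rho_gt0 : 0 < rho) (rho_lt1 : rho < 1).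
Variable m : {ffun V -> bool} -> R.
Hypotheses (m_ge0 : forall x, 0 <= m x) (m_sum1 : \sum_x m x = 1).
Implicit Type x : {ffun V -> bool}.

Let H : R := \sum_x m x * ln (m x / \prod_i (if x i then rho else 1 - rho)).

Lemma entropy_bernoulli_ge0 : 0 <= H.
Proof.
have [p [_ p2 _]] := exists_prediction rho_gt0 rho_lt1 m_ge0 m_sum1.
rewrite -(@pmulr_rge0 _ 2) //; apply: le_trans p2.
apply: sumr_ge0 => x _; rewrite mulr_ge0 // sumr_ge0 // => i _; exact: sqr_ge0.
Qed.

Let cen x i : R := centered rho i x.

(** Off-diagonal terms of the expanded square have zero mean, and the diagonal ones are at most
    [a i ^+ 2]. *)
Lemma orthogonal_sum_sqr (xi : V -> {ffun V -> bool} -> R) (a : V -> R) :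
  (forall i x, `|xi i x| <= 1) ->
  (forall i j, i != j -> \sum_x m x * (xi i x * xi j x) = 0) ->
  \sum_x m x * (\sum_i a i * xi i x) ^+ 2 <= \sum_i a i ^+ 2.
Proof.
move=> xi1 xio.
have -> : \sum_x m x * (\sum_i a i * xi i x) ^+ 2 =
    \sum_i \sum_j a i * a j * \sum_x m x * (xi i x * xi j x).
  under eq_bigr => x _.
    rewrite expr2 mulr_suml mulr_sumr.
    under eq_bigr do rewrite !mulr_sumr.
    over.
  rewrite exchange_big /=; apply: eq_bigr => i _.
  rewrite exchange_big /=; apply: eq_bigr => j _.
  by rewrite mulr_sumr; apply: eq_bigr => x _; ring.
apply: ler_sum => i _; rewrite (bigD1 i) //= [X in _ + X]big1 => [|j ji]; last first.
  by rewrite xio ?mulr0 // eq_sym.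
rewrite addr0 -expr2 -[leRHS]mulr1 ler_wpM2l ?sqr_ge0 //.
rewrite -m_sum1; apply: ler_sum => x _.
rewrite -[leRHS]mulr1 ler_wpM2l // -expr2 -(expr1n _ 2) -real_normK ?num_real //.
by rewrite ler_sqr ?nnegrE.
Qed.

(** Split the centered configuration into prediction and error. Young's inequality and the entropy
    bound on the predictions give the first term, orthogonality of the errors the second; (a + b)^2
    <= 2 a^2 + 2 b^2 doubles both. *)
Lemma expect_conv_sqr K : (forall z, 0 <= K z) ->
  \sum_x m x * \sum_w conv K (cen x) w ^+ 2 <=
  4 * (\sum_z K z) ^+ 2 * H + 2 * #|V|%:R * \sum_z K z ^+ 2.
Proof.
move=> K0; have [p [p1 p2 po]] := exists_prediction rho_gt0 rho_lt1 m_ge0 m_sum1.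
pose xi x i := cen x i - p i x.
have bound x : \sum_w conv K (cen x) w ^+ 2 <=
    2 * (\sum_z K z) ^+ 2 * \sum_i p i x ^+ 2 + 2 * \sum_w conv K (xi x) w ^+ 2.
  rewrite -mulrA; apply: (@le_trans _ _ (2 * (\sum_w conv K (p^~ x) w ^+ 2) +
      2 * \sum_w conv K (xi x) w ^+ 2)); last first.
    by rewrite lerD2r ler_wpM2l //; exact: young_l2.
  rewrite !mulr_sumr -big_split /=; apply: ler_sum => w _.
  have -> : conv K (cen x) w = conv K (p^~ x) w + conv K (xi x) w.
    rewrite /conv -big_split /=; apply: eq_bigr => z _.
    by rewrite -mulrDr /xi [p _ _ + _]addrC subrK.
  set a := conv _ _ _; set b := conv _ _ _.
  have := sqr_ge0 (a - b); lra.
apply: (@le_trans _ _ (\sum_x m x * (2 * (\sum_z K z) ^+ 2 * \sum_i p i x ^+ 2 +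
    2 * \sum_w conv K (xi x) w ^+ 2))).
  by apply: ler_sum => x _; rewrite ler_wpM2l.
under eq_bigr do rewrite mulrDr mulrCA [m _ * (2 * _)]mulrCA.
rewrite big_split /= -!mulr_sumr lerD //.
  rewrite [leRHS](_ : _ = 2 * (\sum_z K z) ^+ 2 * (2 * H)); last by ring.
  by rewrite ler_wpM2l // mulr_ge0 // sqr_ge0.
rewrite -mulrA ler_wpM2l //.
under [X in X <= _]eq_bigr do rewrite mulr_sumr.
rewrite exchange_big /= -sum1_card natr_sum mulr_suml; apply: ler_sum => w _.
rewrite mul1r.
have -> : \sum_z K z ^+ 2 = \sum_z K (z - w) ^+ 2.
  by rewrite -[LHS](sum_shift _ (- w)); apply: eq_bigr => z _; rewrite addrC.
apply: le_trans (orthogonal_sum_sqr (xi := fun i x => xi x i) _ _ _); last 2 first.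
- by move=> i x; exact: p1.
- by move=> i j ij; exact: po.
apply: ler_sum => x _; rewrite ler_wpM2l //.
rewrite (_ : conv K (xi x) w = \sum_i K (i - w) * xi x i) //.
rewrite -[RHS](sum_shift _ w); apply: eq_bigr => z _.
by rewrite [w + z]addrC addrK.
Qed.

(** Because [K 0 = 0], the product of errors with errors has zero mean. Each other product contains
    a prediction, once [conv_adjoint] has moved the convolution, and is split by 2 a b <= a^2 +
    b^2. *)
Lemma expect_conv_bilinear K : (forall z, 0 <= K z) -> \sum_z K z = 1 -> K 0 = 0 ->
  \sum_x m x * \sum_w cen x w * conv K (cen x) w <=
  4 * H + 2 * #|V|%:R * \sum_z K z ^+ 2.
Proof.
move=> K0 K1 K00; have Q := expect_conv_sqr K0; rewrite K1 expr1n mulr1 in Q.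
have [p [p1 p2 po]] := exists_prediction rho_gt0 rho_lt1 m_ge0 m_sum1.
rewrite -/H in p2.
pose xi x i := cen x i - p i x; pose K' z := K (- z).
have split3 x : \sum_w cen x w * conv K (cen x) w <=
    \sum_i p i x ^+ 2 + 2^-1 * (\sum_w conv K (cen x) w ^+ 2) +
    2^-1 * (\sum_w conv K' (xi x) w ^+ 2) + \sum_w xi x w * conv K (xi x) w.
  have -> : \sum_w cen x w * conv K (cen x) w =
     \sum_w p w x * conv K (cen x) w + \sum_w xi x w * conv K (p^~ x) w +
     \sum_w xi x w * conv K (xi x) w.
    rewrite -!big_split /=; apply: eq_bigr => w _.
    have -> : conv K (cen x) w = conv K (p^~ x) w + conv K (xi x) w.
      rewrite /conv -big_split /=; apply: eq_bigr => z _.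
      by rewrite -mulrDr /xi [p _ _ + _]addrC subrK.
    have -> : cen x w = p w x + xi x w by rewrite /xi [p _ _ + _]addrC subrK.
    ring.
  rewrite lerD2r (conv_adjoint K (p^~ x) (xi x)) -/K'.
  rewrite !mulr_sumr -!big_split /=; apply: ler_sum => w _.
  move: (conv K (cen x) w) (conv K' (xi x) w) (p w x) => a b e.
  have := sqr_ge0 (e - a); have := sqr_ge0 (e - b); lra.
have D : \sum_x m x * (\sum_w xi x w * conv K (xi x) w) = 0.
  under eq_bigr do rewrite mulr_sumr.
  rewrite exchange_big /= big1 // => w _.
  under eq_bigr do rewrite /conv !mulr_sumr.
  rewrite exchange_big /= big1 // => z _.
  have [->|z0] := eqVneq z 0; first by rewrite big1 // => x _; rewrite K00 mul0r !mulr0.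
  rewrite -[RHS](mulr0 (K z)) -[X in _ = _ * X](po w (w + z)); last first.
    by rewrite -subr_eq0 opprD addrA subrr sub0r oppr_eq0.
  by rewrite mulr_sumr; apply: eq_bigr => x _; rewrite /xi /cen; ring.
have E : \sum_x m x * (\sum_w conv K' (xi x) w ^+ 2) <= #|V|%:R * \sum_z K z ^+ 2.
  under [X in X <= _]eq_bigr do rewrite mulr_sumr.
  rewrite exchange_big /= -sum1_card natr_sum mulr_suml; apply: ler_sum => w _.
  rewrite mul1r.
  have -> : \sum_z K z ^+ 2 = \sum_z K (w - z) ^+ 2.
    by rewrite -(sum_shift (fun z => K z ^+ 2) w) -[LHS]sum_opp.
  apply: le_trans (orthogonal_sum_sqr (xi := fun i x => xi x i) _ _ _); last 2 first.
  - by move=> i x; exact: p1.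
  - by move=> i j ij; exact: po.
  apply: ler_sum => x _; rewrite ler_wpM2l //.
  rewrite (_ : conv K' (xi x) w = \sum_i K (w - i) * xi x i) //.
  rewrite -[RHS](sum_shift _ w); apply: eq_bigr => z _.
  by rewrite /K' opprD addrA subrr sub0r.
apply: le_trans (ler_sum _ (fun x _ => ler_wpM2l (m_ge0 x) (split3 x))) _.
under eq_bigr do rewrite !mulrDr [m _ * (2^-1 * _)]mulrCA [m _ * (2^-1 * \sum_w conv K' _ w ^+ 2)]mulrCA.
rewrite !big_split /= D addr0 -!mulr_sumr.
have : 0 <= #|V|%:R * \sum_z K z ^+ 2.
  by rewrite mulr_ge0 // sumr_ge0 // => z _; exact: sqr_ge0.
lra.
Qed.

End Convolution.

(** * Box averages and flows on the torus *)

Section TorusKernels.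
Variables (R : realType) (d n : nat).
Hypothesis n_gt2 : (2 < n)%N.
Implicit Types (k l m : nat) (i j : 'I_d) (z w x y : torus d n).

Lemma Zp_trunc_succ2 : (Zp_trunc n).+2 = n.
Proof. by apply: Zp_cast; apply: ltnW. Qed.

Lemma ltn_Zn (p : 'Z_n) : (p < n)%N.
Proof. by rewrite -[X in (_ < X)%N]Zp_trunc_succ2. Qed.

Lemma Zn_succ (p : 'Z_n) :
  (nat_of_ord (p + 1) = p.+1 /\ (p.+1 < n)%N) \/
  (nat_of_ord (p + 1) = 0%N /\ p.+1 = n).
Proof.
have E : nat_of_ord (p + 1) = (p.+1 %% n)%N.
  by rewrite /= (@modn_small 1) // addn1; congr (_ %% _)%N; exact: Zp_trunc_succ2.
have := ltn_Zn p; rewrite leq_eqVlt => /orP[/eqP pn|pn].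
  by right; rewrite E pn modnn.
by left; rewrite E modn_small.
Qed.

Lemma Zn_opp1 : nat_of_ord (- 1 : 'Z_n) = n.-1.
Proof.
have [[]|[_ H]] := Zn_succ (-1); first by rewrite addNr.
by rewrite -[in RHS]H.
Qed.

Lemma Zn_opp2 : nat_of_ord (- 1 - 1 : 'Z_n) = n.-2.
Proof.
have [[H _]|[H _]] := Zn_succ (-1 - 1).
  by move: H; rewrite subrK Zn_opp1 => ->.
move: H; rewrite subrK Zn_opp1; move: n_gt2; case: (n) => [|[|]] //.
Qed.

Lemma sum_Zn (F : nat -> R) : \sum_(p : 'Z_n) F p = \sum_(0 <= m < n) F m.
Proof. by rewrite -[in RHS]Zp_trunc_succ2 big_mkord. Qed.

Definition prodker (g : 'I_d -> nat -> R) z : R := \prod_j g j (z 0 j).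

Lemma sum_prodker g : \sum_z prodker g z = \prod_j \sum_(0 <= m < n) g j m.
Proof.
under [RHS]eq_bigr do rewrite -sum_Zn.
rewrite bigA_distr_bigA /=.
rewrite (reindex_onto (fun f : {ffun 'I_d -> 'Z_n} => \row_j f j)
  (fun z : torus d n => [ffun j => z 0 j])) /=; last first.
  by move=> z _; apply/rowP => j; rewrite mxE ffunE.
apply: eq_big => [f|f _].
  by apply/eqP/ffunP => j; rewrite ffunE mxE.
by apply: eq_bigr => j _; rewrite mxE.
Qed.

Lemma prodker_ge0 g z : (forall j m, 0 <= g j m) -> 0 <= prodker g z.
Proof. by move=> g0; apply: prodr_ge0. Qed.

Lemma ler_prodker g h z : (forall j m, 0 <= g j m <= h j m) ->
  prodker g z <= prodker h z.
Proof. by move=> gh; apply: ler_prod => j _. Qed.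

Definition unif k m : R := if (m < k)%N then k%:R^-1 else 0.
(** The partial sums of [unif k - unif k.+1]: the flow along a line that carries the uniform law on
    [k] sites to the one on [k.+1] sites. *)
Definition ramp k m : R := if (m < k)%N then m.+1%:R / (k%:R * k.+1%:R) else 0.

Lemma unif_ge0 k m : 0 <= unif k m.
Proof. by rewrite /unif; case: ifP => // _; rewrite invr_ge0. Qed.

Lemma unif_le k m : unif k m <= k%:R^-1.
Proof. by rewrite /unif; case: ifP => // _; rewrite invr_ge0. Qed.

Lemma unifS_le k m : (0 < k)%N -> unif k.+1 m <= k%:R^-1.
Proof.
move=> k0; apply: le_trans (unif_le _ _) _.
by rewrite lef_pV2 ?posrE ?ltr0n // ler_nat.
Qed.

Lemma ramp_ge0 k m : 0 <= ramp k m.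
Proof. by rewrite /ramp; case: ifP => // _; rewrite divr_ge0 ?mulr_ge0. Qed.

Lemma ramp_le_unif k m : ramp k m <= unif k m.
Proof.
rewrite /ramp /unif; case: ifP => // mk.
have k0 : (0 < k)%N by apply: leq_trans mk.
rewrite invfM mulrCA ler_piMr ?invr_ge0 // ler_pdivrMr ?ltr0n // mul1r ler_nat.
exact: leqW.
Qed.

Lemma sum_unif k : (0 < k <= n)%N -> \sum_(0 <= m < n) unif k m = 1.
Proof.
move=> /andP[k0 kn]; rewrite (big_cat_nat (n := k)) //=.
rewrite [X in _ + X]big_nat_cond [X in _ + X]big1 => [|m]; last first.
  by rewrite andbT => /andP[km _]; rewrite /unif ltnNge km.
rewrite addr0 big_nat_cond (eq_bigr (fun=> k%:R^-1)); last first.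
  by move=> m; rewrite andbT => /andP[_ mk]; rewrite /unif mk.
rewrite -big_nat_cond sumr_const_nat subn0 -[_ *+ _]mulr_natr mulVf //.
by rewrite pnatr_eq0 -lt0n.
Qed.

Lemma unif_ramp k (p : 'Z_n) : (0 < k < n)%N ->
  unif k (p + 1)%R - unif k.+1 (p + 1)%R = ramp k (p + 1)%R - ramp k p.
Proof.
move=> /andP[k0 kn]; have kn0 : k%:R != 0 :> R by rewrite pnatr_eq0 -lt0n.
have kS0 : k%:R + 1 != 0 :> R by rewrite natr1 pnatr_eq0.
have [[-> _]|[-> pn]] := Zn_succ p.
  have [pk|kp|pk] := ltngtP p.+1 k; rewrite /unif /ramp.
  - by rewrite pk (ltnW pk : (p < k)%N) (leqW pk) -!natr1; field; rewrite kn0 kS0.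
  - rewrite [(p.+1 < k)%N]ltnNge (ltnW kp) ltnS leqNgt kp /=.
    by rewrite !subr0.
  - rewrite -pk ltnn ltnSn leqnn /= -natr1 in kn0 kS0 *.
    by rewrite -!natr1; field; rewrite kn0 kS0.
(* Here [p + 1] wraps around from n - 1 to 0; [ramp k] vanishes at n - 1 because [k < n]. *)
rewrite /unif /ramp k0 ltnS leq0n [(p < k)%N]ltnNge -ltnS pn kn /= -!natr1.
by field; rewrite kn0 kS0.
Qed.

(** Change the factors from [a] to [b] one at a time, from the left. *)
Lemma prodr_telescope (D : nat) (a b : 'I_D -> R) :
  \prod_j a j - \prod_j b j =
  \sum_(i < D) \prod_(j < D)
    (if (j < i)%N then b j else if (j == i :> nat) then a j - b j else a j).
Proof.
elim: D a b => [|D IH] a b; first by rewrite !big_ord0 subrr.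
rewrite [in RHS]big_ord_recr /= 2!big_ord_recr /=.
rewrite [X in _ = _ + X]big_ord_recr /= ltnn eqxx.
rewrite [X in _ = _ + X * _](eq_bigr (fun j : 'I_D => b (widen_ord (leqnSn D) j))); last first.
  by move=> j _; rewrite /= ltn_ord.
rewrite [X in _ = X + _](eq_bigr (fun i : 'I_D => \prod_(j < D) (if (j < i)%N then
   b (widen_ord (leqnSn D) j) else if (j == i :> nat) then
   a (widen_ord (leqnSn D) j) - b (widen_ord (leqnSn D) j) else
   a (widen_ord (leqnSn D) j)) * a ord_max)); last first.
  move=> i _; rewrite big_ord_recr /=.
  by rewrite ltnNge (ltnW (ltn_ord i)) /= gtn_eqF.
by rewrite -mulr_suml -IH; ring.
Qed.

Definition box k z : R := prodker (fun _ => unif k) z.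

(** The box is enlarged one direction at a time: directions before [i] already have side [k.+1],
    those after [i] still have side [k], and the mass moves along [i]. *)
Definition flux k i z : R := prodker (fun j =>
  if (j < i)%N then unif k.+1 else if (j == i :> nat) then ramp k else unif k) z.

Lemma flux_ge0 k i z : 0 <= flux k i z.
Proof.
apply: prodker_ge0 => j m.
by case: ifP => _; [|case: ifP => _]; rewrite ?unif_ge0 ?ramp_ge0.
Qed.

Lemma box_flux k z : (0 < k < n)%N ->
  box k z - box k.+1 z =
  \sum_i (flux k i z - flux k i (z - unit_vec 'Z_n i)).
Proof.
move=> kn; rewrite /box /prodker prodr_telescope; apply: eq_bigr => i _.
rewrite /flux /prodker (bigD1 i) //= ltnn eqxx [X in _ = X - _](bigD1 i) //=.
rewrite [X in _ = _ - X](bigD1 i) //= ltnn eqxx.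
have E : \prod_(j < d | j != i)
    (if (j < i)%N then unif k.+1 else if (j == i :> nat) then ramp k else unif k)
      ((z - unit_vec 'Z_n i) 0 j) =
  \prod_(j < d | j != i)
    (if (j < i)%N then unif k.+1 else if (j == i :> nat) then ramp k else unif k)
      (z 0 j).
  by apply: eq_bigr => j ji; rewrite !mxE eqxx (negbTE ji) andbF subr0.
rewrite E -mulrBl; congr (_ * _); last first.
  apply: eq_bigr => j ji; case: ifP => // _.
  by rewrite (negbTE (_ : (j != i :> nat))).
have := unif_ramp (z 0 i - 1) kn; rewrite subrK => ->.
by rewrite !mxE !eqxx.
Qed.

Lemma flux_le k i z : (0 < k)%N -> flux k i z <= k%:R^-1 ^+ d.
Proof.
move=> k0; rewrite -[X in _ <= _ ^+ X]card_ord -prodr_const.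
apply: ler_prod => j _.
case: ifP => _; first by rewrite unif_ge0 unifS_le.
case: ifP => _; last by rewrite unif_ge0 unif_le.
by rewrite ramp_ge0 (le_trans (ramp_le_unif _ _)) // unif_le.
Qed.

Lemma sum_flux k i : (0 < k < n)%N -> \sum_z flux k i z <= 1.
Proof.
move=> /andP[k0 kn].
pose g (j : 'I_d) := if (j < i)%N then unif k.+1 else unif k.
apply: (@le_trans _ _ (\sum_z prodker g z)).
  apply: ler_sum => z _; apply: ler_prodker => j m; rewrite /g.
  case: ifP => _; first by rewrite unif_ge0 lexx.
  by case: ifP => _; rewrite ?ramp_ge0 ?ramp_le_unif ?unif_ge0 ?lexx.
rewrite sum_prodker big1 // => j _; rewrite /g.
by case: ifP => _; rewrite sum_unif // ?kn // k0 ltnW.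
Qed.

Lemma sum_box k : (0 < k <= n)%N -> \sum_z box k z = 1.
Proof. by move=> kn; rewrite sum_prodker big1 // => j _; rewrite sum_unif. Qed.

Lemma box_ge0 k z : 0 <= box k z.
Proof. by apply: prodker_ge0 => j m; exact: unif_ge0. Qed.

Lemma sum_box_sqr k : (0 < k <= n)%N -> \sum_z box k z ^+ 2 <= k%:R^-1 ^+ d.
Proof.
move=> kn; rewrite -[leRHS]mulr1 -[X in _ <= _ * X](sum_box kn) mulr_sumr; apply: ler_sum => z _.
rewrite expr2 ler_wpM2r ?box_ge0 // -[X in _ <= _ ^+ X](card_ord d) -prodr_const.
by rewrite /box /prodker; apply: ler_prod => j _; rewrite unif_ge0 unif_le.
Qed.

Lemma box1 z : box 1 z = (z == 0)%:R.
Proof.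
rewrite /box /prodker; have [->|z0] := eqVneq z 0.
  by rewrite big1 // => j _; rewrite mxE /unif /= invr1.
have [j zj] : exists j, z 0 j != 0.
  apply/existsP; rewrite -negb_forall; apply: contra z0 => /forallP H.
  by apply/eqP/rowP => j; rewrite mxE; apply/eqP.
rewrite (bigD1 j) //= /unif ltnS leqn0 ifF ?mul0r //.
by apply: contraNF zj => /eqP H; apply/eqP/val_inj.
Qed.

Lemma box_eq0 k z j : (k <= z 0%R j)%N -> box k z = 0.
Proof.
by move=> kz; rewrite /box /prodker (bigD1 j) //= /unif ltnNge kz mul0r.
Qed.

(** The total flow from the point mass at 0, which is the box of side 1, through the successive
    boxes up to side [l.+1]; hence the index [k.+1]. *)
Definition flow l i z : R := \sum_(k < l) flux k.+1 i z.

Lemma flow_ge0 l i z : 0 <= flow l i z.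
Proof. by apply: sumr_ge0 => k _; exact: flux_ge0. Qed.

Lemma box_flow l z : (l < n)%N ->
  (z == 0)%:R - box l.+1 z =
  \sum_i (flow l i z - flow l i (z - unit_vec 'Z_n i)).
Proof.
rewrite -box1; elim: l => [|l IH] ln.
  by rewrite subrr big1 // => i _; rewrite /flow !big_ord0 subrr.
rewrite -(subrK (box l.+1 z) (box 1 z)) -addrA IH ?(ltnW ln) // box_flux //.
rewrite -big_split /=; apply: eq_bigr => i _.
by rewrite /flow !big_ord_recr /=; ring.
Qed.

Lemma sum_flow l i : (l < n)%N -> \sum_z flow l i z <= l%:R.
Proof.
move=> ln; rewrite exchange_big /= -[l in leRHS]card_ord -sumr_const.
by apply: ler_sum => k _; apply: sum_flux => /=; apply: leq_ltn_trans ln.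
Qed.

(* Successive fluxes are compared through sup(flux k) * sum(flow), which gives
   the dimension dependence of the error term without counting lattice points. *)
Lemma sum_flow_sqr l i : (l < n)%N ->
  \sum_z flow l i z ^+ 2 <= 2 * \sum_(k < l) k.+1%:R * k.+1%:R^-1 ^+ d.
Proof.
elim: l => [|l IH] ln.
  by rewrite big_ord0 mulr0 big1 // => z _; rewrite /flow big_ord0 expr0n.
have ln' := ltnW ln.
rewrite big_ord_recr /= mulrDr.
pose s : R := l.+1%:R^-1 ^+ d.
have s0 : 0 <= s by rewrite exprn_ge0 // invr_ge0.
have fs z : flux l.+1 i z <= s by exact: flux_le.
have -> : \sum_z flow l.+1 i z ^+ 2 = \sum_z flow l i z ^+ 2 +
    \sum_z flux l.+1 i z * (2 * flow l i z + flux l.+1 i z).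
  rewrite -big_split /=; apply: eq_bigr => z _.
  by rewrite /flow big_ord_recr /=; ring.
apply: lerD; first exact: IH.
apply: (@le_trans _ _ (\sum_z s * (2 * flow l i z + flux l.+1 i z))).
  apply: ler_sum => z _; rewrite ler_wpM2r ?fs //.
  by rewrite addr_ge0 ?flux_ge0 // mulr_ge0 // flow_ge0.
rewrite -mulr_sumr big_split /= -mulr_sumr -/s.
rewrite [leRHS](_ : _ = s * (2 * l.+1%:R)); last by ring.
rewrite ler_wpM2l //.
(* The masses of [flow l] and of the new flux are at most l and 1, and 2 l + 1 <= 2 (l + 1). *)
have h1 := sum_flow i ln'; have h2 := @sum_flux l.+1 i ln.
rewrite -natr1; lra.
Qed.

Lemma flow_eq0 l i z j : (l < z 0%R j)%N -> flow l i z = 0.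
Proof.
move=> lz; rewrite /flow big1 // => k _.
have kl := ltn_ord k.
rewrite /flux /prodker (bigD1 j) //=.
case: ifP => _; first by rewrite /unif ltnNge (leq_trans _ lz) ?mul0r.
by case: ifP => _; rewrite /unif /ramp ltnNge (leq_trans _ (ltnW lz)) ?mul0r.
Qed.

(** The flow seen from the bond it crosses: if w = x + e_j + z is the base point of the bond, then x
    = w + y with z = - e_j - y. *)
Definition flow_kernel l i j y : R := flow l i (- unit_vec 'Z_n j - y).

Lemma unit_vecE i j : unit_vec 'Z_n i 0 j = (j == i)%:R.
Proof. by rewrite mxE eqxx. Qed.

(** With [flow_kernel_unit], the kernel ignores both endpoints of the bond, so that exchanging them
    does not affect the convolution. In direction [j] the argument of the flow is -1 or -2 modulo n,
    beyond its support because [l.+3 <= n]. *)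
Lemma flow_kernel0 l i j : (l.+3 <= n)%N -> flow_kernel l i j 0 = 0.
Proof.
move=> ln; rewrite /flow_kernel subr0; apply: (@flow_eq0 l i _ j).
rewrite mxE unit_vecE eqxx Zn_opp1.
by case: (n) ln => [|[|m]] // /ltnW.
Qed.

Lemma flow_kernel_unit l i j : (l.+3 <= n)%N ->
  flow_kernel l i j (unit_vec 'Z_n i) = 0.
Proof.
move=> ln; rewrite /flow_kernel; apply: (@flow_eq0 l i _ j).
rewrite !mxE !eqxx; case: (j == i).
  suff: (l < nat_of_ord (- 1 - 1 : 'Z_n)%R)%N by [].
  by rewrite Zn_opp2; case: (n) ln => [|[|m]].
suff: (l < nat_of_ord (- 1 - 0 : 'Z_n)%R)%N by [].
by rewrite subr0 Zn_opp1; case: (n) ln => [|[|m]] // /ltnW.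
Qed.

Lemma sum_flow_kernel (F : R -> R) l i j :
  \sum_y F (flow_kernel l i j y) = \sum_y F (flow l i y).
Proof.
rewrite -[RHS](sum_shift _ (- unit_vec 'Z_n j)) -[LHS]sum_opp.
by apply: eq_bigr => y _; rewrite /flow_kernel opprK.
Qed.

Definition box_kernel l j y : R := box l.+1 (y - unit_vec 'Z_n j).

Lemma box_kernel0 l j : (l.+3 <= n)%N -> box_kernel l j 0 = 0.
Proof.
move=> ln; rewrite /box_kernel sub0r; apply: (@box_eq0 l.+1 _ j).
rewrite mxE unit_vecE eqxx Zn_opp1.
by case: (n) ln => [|[|m]] // /ltnW.
Qed.

Lemma sum_box_kernel (F : R -> R) l j :
  \sum_y F (box_kernel l j y) = \sum_y F (box l.+1 y).
Proof.
rewrite -[RHS](sum_shift _ (- unit_vec 'Z_n j)).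
by apply: eq_bigr => y _; rewrite /box_kernel addrC.
Qed.

(** Write the value at x + e_j as its box average plus a remainder. By [box_flow] the remainder is
    paired with the divergence of [flow l i], and summation by parts moves the difference onto
    [u]. *)
Lemma correlation_decomposition (u : torus d n -> R) l j : (l < n)%N ->
  \sum_x u x * u (x + unit_vec 'Z_n j) =
  \sum_x u x * conv (box_kernel l j) u x +
  \sum_i \sum_w (u w - u (w + unit_vec 'Z_n i)) * conv (flow_kernel l i j) u w.
Proof.
move=> ln; set e := fun j => unit_vec 'Z_n j.
have flowE i : \sum_w (u w - u (w + e i)) * conv (flow_kernel l i j) u w =
    \sum_x u x * \sum_z (flow l i z - flow l i (z - e i)) * u (x + e j + z).
  transitivity (\sum_x u x * \sum_z flow l i z *
      (u (x + e j + z) - u (x + e j + z + e i))).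
    under eq_bigr do rewrite /conv mulr_sumr.
    under [RHS]eq_bigr do rewrite mulr_sumr.
    rewrite exchange_big [RHS]exchange_big /=.
    rewrite -[LHS](sum_shift _ (- e j)) -[LHS]sum_opp; apply: eq_bigr => z _.
    rewrite /flow_kernel opprB addrCA subrr addr0.
    rewrite -[LHS](sum_shift _ (e j + z)); apply: eq_bigr => w _.
    have -> : e j + z + w + (- e j - z) = w by rewrite addrAC -opprD subrr add0r.
    by rewrite [_ + w]addrC !addrA; ring.
  apply: eq_bigr => x _; congr (_ * _).
  under eq_bigr do rewrite mulrBr.
  under [RHS]eq_bigr do rewrite mulrBl.
  rewrite !sumrB; congr (_ - _).
  rewrite -[RHS](sum_shift _ (e i)); apply: eq_bigr => z _.
  by rewrite [e i + z]addrC addrK addrA.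
transitivity (\sum_x u x * conv (box_kernel l j) u x + \sum_i \sum_x u x *
    \sum_z (flow l i z - flow l i (z - e i)) * u (x + e j + z)); last first.
  by congr (_ + _); apply: eq_bigr => i _; rewrite -flowE.
rewrite exchange_big -big_split /=; apply: eq_bigr => x _.
rewrite -mulr_sumr -mulrDr; congr (_ * _).
rewrite exchange_big /=.
under [X in _ = _ + X]eq_bigr do rewrite -mulr_suml -box_flow //.
have -> : conv (box_kernel l j) u x = \sum_z box l.+1 z * u (x + e j + z).
  rewrite /conv -[LHS](sum_shift _ (e j)); apply: eq_bigr => z _.
  by rewrite /box_kernel [e j + z]addrC addrK -addrA [z + _]addrC.
rewrite -big_split /= (bigD1 0) //= eqxx addr0 big1 ?addr0.
  by rewrite mulrBl mul1r addrC subrK.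
by move=> z z0; rewrite (negbTE z0) sub0r mulNr subrr.
Qed.

End TorusKernels.

(** * The voter model with stirring *)

Lemma sum_pair (R : nmodType) (I J : finType) (F : I * J -> R) :
  \sum_p F p = \sum_i \sum_j F (i, j).
Proof. by rewrite pair_bigA; apply: eq_bigr => -[]. Qed.

(** Interpolate from [w] to [w'] by changing the coordinates in the finite list [A] one at a time:
    each change either does nothing or flips a coordinate outside [dep_support f]. *)
Lemma cylinder_dep_support (R : realType) (d : nat) (f : config d -> R)
    (w w' : config d) :
  cylinder f -> (forall z, dep_support f z -> w z = w' z) -> f w = f w'.
Proof.
move=> [A fA] ww'.
have flip z v : ~ dep_support f z -> f (flip_at z v) = f v.
  by move=> nz; apply/eqP; apply: contrapT => /negP H; apply: nz; exists v.
pose g (s : seq 'rV[int]_d) : config d := fun z => if z \in s then w' z else w z.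
suff E s : f (g s) = f w.
  by rewrite -(E A); apply: fA => z zA; rewrite /g zA.
elim: s => [|z s IH]; first by congr f; apply/funext => z; rewrite /g in_nil.
rewrite -IH; have [gz|gz] := eqVneq (g s z) (w' z).
  congr f; apply/funext => y; rewrite /g inE; case: eqP => //= ->.
  by move: gz; rewrite /g; case: ifP.
have -> : g (z :: s) = flip_at z (g s).
  apply/funext => y; rewrite /flip_at {1}/g inE; case: eqP => //= ->.
  by move: gz; case: (g s z); case: (w' z).
apply: flip => /ww' e; move: gz; rewrite /g; case: ifP => _; rewrite ?e eqxx //.
Qed.

Section Generator.
Variables (R : realType) (d n : nat) (c : 'I_d -> config d -> R) (c0 an rho : R).
Hypotheses (c0_gt0 : 0 < c0) (c_ge : forall j w, c0 <= c j w)
  (an_gt0 : 0 < an) (rho_gt0 : 0 < rho) (rho_lt1 : rho < 1).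
Implicit Types (i j : 'I_d) (x y z w : torus d n) (eta : Omega d n).

Let e j := unit_vec 'Z_n j.
Let swap x j eta : Omega d n := finfun (exchange x (x + e j) eta).
Let flip x eta : Omega d n := finfun (flip_at x eta).
(** The possible transitions: a site and a direction for the stirring, an ordered pair of sites for
    the voter dynamics, where [bond_rate] gives rate 0 to pairs that are not neighbours. *)
Let bond : finType := ((torus d n * 'I_d) + (torus d n * torus d n))%type.

Definition bond_rate (b : bond) eta : R :=
  match b with
  | inl (x, j) => n%:R ^+ 2 * c j (Defs.periodic (translate x eta))
  | inr (x, y) =>
      if torus_norm (y - x) == 1%N then an * ((eta y)%:R - (eta x)%:R) ^+ 2 else 0
  end.

Definition bond_map (b : bond) eta : Omega d n :=
  match b with inl (x, j) => swap x j eta | inr (x, _) => flip x eta end.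

Lemma gen_jump : gen c an = jump_gen bond_rate bond_map.
Proof.
apply/funext => f; apply/funext => eta; rewrite /gen /jump_gen big_sumType /=.
rewrite /gen_stirring /gen_voter !mulr_sumr; congr (_ + _).
  rewrite [RHS]sum_pair /=; apply: eq_bigr => x _.
  by rewrite mulr_sumr; apply: eq_bigr => j _; rewrite mulrA.
rewrite [RHS]sum_pair /=; apply: eq_bigr => x _.
rewrite mulr_sumr big_mkcond; apply: eq_bigr => y _.
by case: ifP => _; rewrite ?mul0r // mulrA.
Qed.

Lemma bond_rate_ge0 b eta : 0 <= bond_rate b eta.
Proof.
case: b => -[x j] /=.
  by rewrite mulr_ge0 ?exprn_ge0 // (le_trans (ltW c0_gt0)).
by case: ifP => // _; rewrite mulr_ge0 ?sqr_ge0 // ltW.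
Qed.

Lemma exchangeE x y (eta : torus d n -> bool) z :
  exchange x y eta z = eta (tperm x y z).
Proof. by rewrite /exchange permE /=; case: eqP => // _; case: eqP. Qed.

Lemma swapE x j eta z : swap x j eta z = eta (tperm x (x + e j) z).
Proof. by rewrite ffunE exchangeE. Qed.

Lemma swapK x j : involutive (swap x j).
Proof. by move=> eta; apply/ffunP => z; rewrite !swapE tpermK. Qed.

Lemma flipK x : involutive (flip x).
Proof.
move=> eta; apply/ffunP => z; rewrite !ffunE /flip_at !ffunE /flip_at eqxx.
by case: eqP => [->|]; rewrite ?negbK.
Qed.

Lemma bernoulli_gt0 eta : 0 < bernoulli_product rho eta.
Proof. by apply: prodr_gt0 => x _; case: ifP => _ //; rewrite subr_gt0. Qed.

Lemma bernoulli_swap x j eta :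
  bernoulli_product rho (swap x j eta) = bernoulli_product rho eta.
Proof.
rewrite /bernoulli_product [RHS](reindex_inj (@perm_inj _ (tperm x (x + e j)))) /=.
by apply: eq_bigr => z _; rewrite swapE.
Qed.

Let chi : R := rho * (1 - rho).

(** This identity computes the adjoint of the voter generator on the constant 1: a flip changes the
    weighted rate by the product of the centered values over [chi]. It is checked on the four values
    of the pair. *)
Lemma bernoulli_flip x y eta : x != y ->
  bernoulli_product rho (flip x eta) * ((flip x eta y)%:R - (flip x eta x)%:R) ^+ 2 =
  bernoulli_product rho eta *
    (((eta y)%:R - (eta x)%:R) ^+ 2 + centered rho x eta * centered rho y eta / chi).
Proof.
move=> xy; rewrite /bernoulli_product (bigD1 x) //= [in RHS](bigD1 x) //=.
have -> : \prod_(z | z != x) (if flip x eta z then rho else 1 - rho) =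
    \prod_(z | z != x) (if eta z then rho else 1 - rho).
  by apply: eq_bigr => z zx; rewrite ffunE /flip_at (negbTE zx).
rewrite !ffunE /flip_at eqxx eq_sym (negbTE xy) /centered /chi.
set P := \prod_(_ | _) _.
have r0 : rho != 0 by rewrite gt_eqF.
have r1 : 1 - rho != 0 by rewrite gt_eqF // subr_gt0.
by case: (eta x); case: (eta y) => /=; field; rewrite r0 r1.
Qed.

Hypotheses (c_cyl : forall j, cylinder (c j)) (c_large : large_enough c n)
  (c_indep : forall j, ~ dep_support (c j) 0 /\ ~ dep_support (c j) (unit_vec int j)).

Lemma torus_proj0 : torus_proj n (0 : 'rV[int]_d) = 0.
Proof. by apply/rowP => k; rewrite !mxE. Qed.

Lemma torus_proj_unit j : torus_proj n (unit_vec int j) = e j.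
Proof. by apply/rowP => k; rewrite !mxE; case: (_ && _). Qed.

(** The source of reversibility: [c j] ignores 0 and e_j, and injectivity of the projection keeps
    its other coordinates away from [x] and [x + e j]. *)
Lemma rate_swap x j eta :
  c j (Defs.periodic (translate x (swap x j eta))) = c j (Defs.periodic (translate x eta)).
Proof.
have [_ inj] := c_large; have [n0 ne] := c_indep j.
apply: cylinder_dep_support => // z zs; rewrite /Defs.periodic /translate swapE tpermD //.
  apply/eqP => xz; apply: n0; suff <- : z = 0 by [].
  apply: (inj j); rewrite ?inE.
  - by left.
  - by right; left.
  - by rewrite torus_proj0; apply: (addrI x); rewrite addr0.
apply/eqP => xz; apply: ne; suff <- : z = unit_vec int j by [].
apply: (inj j); rewrite ?inE.
- by left.
- by right; right.
- by rewrite torus_proj_unit; apply: (addrI x).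
Qed.

Variable m : Omega d n -> R.
Hypotheses (m_prob : is_probability m).
Let nu := bernoulli_product (d := d) (n := n) rho.
Let f eta := m eta / nu eta.

(** Up to normalization, the Dirichlet form of the square root of the density for exchanges across
    one bond at rate 1. *)
Definition swap_energy x j : R :=
  \sum_eta nu eta * (Num.sqrt (f (swap x j eta)) - Num.sqrt (f eta)) ^+ 2.

Definition pair_correlation x y : R :=
  \sum_eta m eta * (centered rho x eta * centered rho y eta).

Lemma mE eta : m eta = nu eta * f eta.
Proof. by rewrite mulrC divfK // gt_eqF // bernoulli_gt0. Qed.

Lemma f_ge0 eta : 0 <= f eta.
Proof. by case: m_prob => m0 _; rewrite divr_ge0 // ltW // bernoulli_gt0. Qed.

Lemma torus_norm_neq x y : torus_norm (y - x) == 1%N -> x != y.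
Proof.
apply: contraL => /eqP ->; rewrite subrr /torus_norm big1 // => j _.
by rewrite mxE min0n.
Qed.

Lemma entropy_production_correlation :
  (forall eta, m eta = 0 -> kernel_adj (jump_rate bond_rate bond_map) m eta = 0) ->
  entropy_production bond_rate bond_map nu m <=
  an / chi * (\sum_x \sum_(y | torus_norm (y - x) == 1%N) pair_correlation x y) -
  n%:R ^+ 2 * c0 * \sum_x \sum_j swap_energy x j.
Proof.
move=> mk; have [m0 m1] := m_prob.
apply: le_trans (entropy_production_le bond_rate_ge0 bernoulli_gt0 m0 mk) _.
rewrite big_sumType /= addrC; apply: lerD.
- rewrite sum_pair /=.
  rewrite mulr_sumr; apply: ler_sum => x _.
  rewrite mulr_sumr [leRHS]big_mkcond; apply: ler_sum => y _.
  case: ifP => [nxy|_]; last by rewrite big1 // => eta _; rewrite mulr0 mul0r.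
  have xy := torus_norm_neq nxy.
  (* The Dirichlet form of the voter part is nonnegative and is dropped. *)
  apply: (@le_trans _ _ (\sum_eta an * (nu eta * ((eta y)%:R - (eta x)%:R) ^+ 2 *
      f (flip x eta) - nu eta * ((eta y)%:R - (eta x)%:R) ^+ 2 * f eta))).
    apply: ler_sum => eta _.
    rewrite -/(nu (flip x eta)) -/(nu eta) -/(f (flip x eta)) -/(f eta).
    set s := (_%:R - _) ^+ 2; set q := (_ - _) ^+ 2.
    rewrite -subr_ge0 (_ : _ - _ = nu eta * (an * s) * q); last by ring.
    have nu0 : 0 <= nu eta by exact: (ltW (bernoulli_gt0 _)).
    have s0 : 0 <= s by exact: sqr_ge0.
    have q0 : 0 <= q by exact: sqr_ge0.
    by do 2!apply: mulr_ge0 => //; apply: mulr_ge0 => //; exact: ltW.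
  rewrite -mulr_sumr -mulrA ler_wpM2l ?(ltW an_gt0) // sumrB.
  rewrite (reindex_inj (inv_inj (flipK x))) /=.
  rewrite -sumrB /pair_correlation mulr_sumr; apply: ler_sum => eta _.
  rewrite flipK bernoulli_flip // mE -/nu.
  by rewrite [leLHS](_ : _ = chi^-1 * (nu eta * f eta *
    (centered rho x eta * centered rho y eta))) //; ring.
- rewrite sum_pair /=.
  rewrite mulr_sumr -sumrN; apply: ler_sum => x _.
  rewrite mulr_sumr -sumrN; apply: ler_sum => j _.
  pose r eta := nu eta * (n%:R ^+ 2 * c j (Defs.periodic (translate x eta))).
  have rs eta : r (swap x j eta) = r eta.
    by rewrite /r rate_swap [nu _]bernoulli_swap.
  (* By reversibility the part linear in [f] cancels, and only the Dirichlet form is left. *)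
  have S0 : \sum_eta r eta * f (swap x j eta) = \sum_eta r eta * f eta.
    rewrite [RHS](reindex_inj (inv_inj (swapK x j))) /=.
    by apply: eq_bigr => eta _; rewrite rs.
  have -> : \sum_eta r eta * (f (swap x j eta) - f eta -
      (Num.sqrt (f (swap x j eta)) - Num.sqrt (f eta)) ^+ 2) =
     - \sum_eta r eta * (Num.sqrt (f (swap x j eta)) - Num.sqrt (f eta)) ^+ 2.
    under eq_bigr do rewrite mulrBr mulrBr.
    by rewrite !sumrB S0 subrr sub0r.
  rewrite lerN2 /swap_energy mulr_sumr.
  apply: ler_sum => eta _; rewrite mulrA ler_wpM2r ?sqr_ge0 //.
  rewrite mulrC /r ler_wpM2l ?(ltW (bernoulli_gt0 _)) // ler_wpM2l ?exprn_ge0 //.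
Qed.

(** The difference D across the bond is antisymmetric under the exchange and [h] is symmetric, so
    the left side is half the integral of h D (f - f'), where f' is the exchanged density. Factor f
    - f' through square roots and split with weight [beta]. *)
Lemma swap_integration_by_parts x j (h : Omega d n -> R) (beta : R) : 0 < beta ->
  (forall eta, h (swap x j eta) = h eta) ->
  \sum_eta m eta * ((centered rho x eta - centered rho (x + e j) eta) * h eta) <=
  beta / 4 * swap_energy x j + beta^-1 * \sum_eta m eta * h eta ^+ 2.
Proof.
move=> b0 hs; pose D eta := centered rho x eta - centered rho (x + e j) eta.
have Ds eta : D (swap x j eta) = - D eta.
  by rewrite /D /centered !swapE tpermL tpermR opprB; ring.
have D1 eta : D eta ^+ 2 <= 1.
  by rewrite /D /centered; case: (eta x); case: (eta _) => /=;
    rewrite opprB addrCA -addrA ?addrA; lra.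
have ns eta : nu (swap x j eta) = nu eta by exact: bernoulli_swap.
have A2 : \sum_eta m eta * (D eta * h eta) =
    2^-1 * \sum_eta nu eta * (h eta * D eta * (f eta - f (swap x j eta))).
  have A1 : \sum_eta m eta * (D eta * h eta) =
      - \sum_eta nu eta * (h eta * D eta * f (swap x j eta)).
    rewrite (reindex_inj (inv_inj (swapK x j))) /= -sumrN; apply: eq_bigr => eta _.
    by rewrite mE Ds hs ns; ring.
  have A3 : \sum_eta m eta * (D eta * h eta) =
      \sum_eta nu eta * (h eta * D eta * f eta).
    by apply: eq_bigr => eta _; rewrite mE; ring.
  have A4 : \sum_eta nu eta * (h eta * D eta * (f eta - f (swap x j eta))) =
     \sum_eta nu eta * (h eta * D eta * f eta) -
     \sum_eta nu eta * (h eta * D eta * f (swap x j eta)).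
    by rewrite -sumrB; apply: eq_bigr => eta _; ring.
  rewrite A4 -A3; lra.
have F : \sum_eta m eta * h eta ^+ 2 =
    \sum_eta 2^-1 * (nu eta * (h eta ^+ 2 * (f eta + f (swap x j eta)))).
  have B1 : \sum_eta m eta * h eta ^+ 2 = \sum_eta nu eta * (h eta ^+ 2 * f eta).
    by apply: eq_bigr => eta _; rewrite mE; ring.
  have B2 : \sum_eta m eta * h eta ^+ 2 =
      \sum_eta nu eta * (h eta ^+ 2 * f (swap x j eta)).
    rewrite (reindex_inj (inv_inj (swapK x j))) /=; apply: eq_bigr => eta _.
    by rewrite mE hs ns; ring.
  rewrite -mulr_sumr.
  have -> : \sum_eta nu eta * (h eta ^+ 2 * (f eta + f (swap x j eta))) =
      \sum_eta m eta * h eta ^+ 2 + \sum_eta m eta * h eta ^+ 2.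
    by rewrite {1}B1 B2 -big_split /=; apply: eq_bigr => eta _; ring.
  lra.
rewrite -/(D _) A2 F /swap_energy !mulr_sumr -big_split /=; apply: ler_sum => eta _.
have fa := sqr_sqrtr (f_ge0 eta); have fb := sqr_sqrtr (f_ge0 (swap x j eta)).
set a := Num.sqrt (f eta) in fa *; set b := Num.sqrt (f (swap x j eta)) in fb *.
rewrite -fa -fb.
(* AM-GM : 2 h D (a - b) (a + b) <= beta (a - b)^2 + h^2 D^2 (a + b)^2 / beta *)
rewrite [leLHS]mulrCA [X in _ <= X + _]mulrCA [X in _ <= _ + beta^-1 * X]mulrCA.
rewrite [X in _ <= _ + X]mulrCA -mulrDr ler_wpM2l ?(ltW (bernoulli_gt0 _)) //.
have q1 := sqr_ge0 (beta * (b - a) + h eta * D eta * (a + b)).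
have q2 : (h eta * D eta * (a + b)) ^+ 2 <= h eta ^+ 2 * (2 * (a ^+ 2 + b ^+ 2)).
  rewrite !exprMn -mulrA ler_wpM2l ?sqr_ge0 //.
  apply: (@le_trans _ _ (1 * (a + b) ^+ 2)).
    by rewrite ler_wpM2r ?sqr_ge0.
  have := sqr_ge0 (a - b); lra.
rewrite -(ler_pM2l b0) [leRHS](_ : _ = beta ^+ 2 / 4 * (b - a) ^+ 2 +
  2^-1 * (h eta ^+ 2 * (a ^+ 2 + b ^+ 2))); last by field; rewrite gt_eqF.
lra.
Qed.

End Generator.

(** * Nearest neighbours on the torus *)

Section Neighbours.
Variables (R : realType) (d n : nat).
Hypothesis n_gt2 : (2 < n)%N.
Implicit Types (i j k : 'I_d) (x y z : torus d n).

Let e j := unit_vec 'Z_n j.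

Lemma val_Zn1 : nat_of_ord (1 : 'Z_n) = 1%N.
Proof. by rewrite /= modn_small. Qed.

Lemma row_oppE (z : torus d n) k : (- z) 0 k = - z 0 k.
Proof. by rewrite mxE. Qed.

Lemma torus_norm_unit j (b : bool) : torus_norm (if b then e j else - e j) = 1%N.
Proof.
rewrite /torus_norm (bigD1 j) //= big1 ?addn0 => [|k kj].
  case: b; rewrite /e ?row_oppE unit_vecE eqxx.
    by rewrite [X in minn X _]val_Zn1 [X in (n - X)%N]val_Zn1; case: (n) n_gt2 => [|[|[|]]].
  rewrite [X in minn X _](Zn_opp1 n_gt2) [X in (n - X)%N](Zn_opp1 n_gt2).
  by case: (n) n_gt2 => [|[|[|q]]] // _; rewrite /= subSnn minnC.
by case: b; rewrite /e ?row_oppE unit_vecE (negbTE kj) ?oppr0 min0n.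
Qed.

Lemma torus_norm1P z : torus_norm z = 1%N -> exists j, z = e j \/ z = - e j.
Proof.
move=> /eqP /sum_nat_eq1 [j [_ zj zk]]; exists j.
have zk0 k : k != j -> z 0 k = 0.
  move=> kj; apply/val_inj => /=; have := zk k kj isT.
  by have := ltn_Zn n_gt2 (z 0 k); rewrite -subn_gt0 /minn; case: ifP => _ // + E; rewrite E.
have [zj1|zj1] : nat_of_ord (z 0 j) = 1%N \/ nat_of_ord (z 0 j) = n.-1.
  move: zj; rewrite /minn; case: ifP => _; first by left.
  have aux p q : (q - p = 1 -> p = q.-1)%N.
    move=> h; have pq : (p <= q)%N by rewrite ltnW // -subn_gt0 h.
    by rewrite -(subnK pq) h.
  by move=> /aux; right.
- left; apply/rowP => k; rewrite unit_vecE; have [->|kj] := eqVneq k j.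
    by apply/val_inj; rewrite /= zj1 modn_small.
  exact: zk0.
- right; apply/rowP => k; rewrite row_oppE unit_vecE; have [->|kj] := eqVneq k j.
    by apply/val_inj; rewrite [LHS]zj1 -(Zn_opp1 n_gt2).
  by rewrite oppr0; exact: zk0.
Qed.

(** Uses n >= 3: for n = 2 the steps e_j and - e_j would coincide. *)
Lemma unit_vec_inj j k (b b' : bool) :
  (if b then e j else - e j) = (if b' then e k else - e k) -> (j == k) && (b == b').
Proof.
have one0 : (1 : 'Z_n) <> 0 by apply/eqP; rewrite oner_neq0.
have oneN : (1 : 'Z_n) <> - 1.
  move=> /(congr1 (@nat_of_ord _)); rewrite val_Zn1 (Zn_opp1 n_gt2).
  by case: (n) n_gt2 => [|[|[|]]].
case: b b' => -[] /rowP /(_ j); rewrite /e ?row_oppE !unit_vecE eqxx;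
  case: (j == k) => // E; exfalso;
  first [ exact: (one0 E) | exact: (oneN E) | exact: (oneN (esym E))
        | exact: (one0 (etrans E (oppr0 _))) | exact: (one0 (oppr_inj E))
        | exact: (one0 (oppr_inj (etrans E (esym (oppr0 _))))) ].
Qed.

Lemma sum_torus_norm1 (G : torus d n -> R) :
  \sum_(z | torus_norm z == 1%N) G z = \sum_j (G (e j) + G (- e j)).
Proof.
pose h (p : 'I_d * bool) : torus d n := if p.2 then e p.1 else - e p.1.
transitivity (\sum_(z in h @: {: 'I_d * bool}) G z).
  apply: eq_bigl => z; apply/eqP/imsetP => [/torus_norm1P [j [->|->]]|[[j b] _ ->]].
  - by exists (j, true).
  - by exists (j, false).
  - exact: torus_norm_unit.
rewrite big_imset /=; last first.
  move=> [j b] [k b'] _ _ hE.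
  by have /andP[/eqP -> /eqP ->] := @unit_vec_inj j k b b' hE.
transitivity (\sum_p G (h p)); first by apply: eq_bigl => p; rewrite inE.
rewrite sum_pair; apply: eq_bigr => j _.
by rewrite big_bool.
Qed.

Lemma sum_neighbours (F : torus d n -> torus d n -> R) :
  (forall x y, F x y = F y x) ->
  \sum_x \sum_(y | torus_norm (y - x) == 1%N) F x y =
  2 * \sum_j \sum_x F x (x + e j).
Proof.
move=> FC.
transitivity (\sum_x \sum_j (F x (x + e j) + F x (x - e j))).
  apply: eq_bigr => x _; rewrite -(sum_torus_norm1 (fun z => F x (x + z))).
  rewrite big_mkcond [RHS]big_mkcond -[LHS](sum_shift _ x).
  by apply: eq_bigr => z _; rewrite addrC addKr.
rewrite exchange_big mulr_sumr; apply: eq_bigr => j _; rewrite big_split /=.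
rewrite mulr_natl mulr2n; congr (_ + _).
rewrite -[LHS](sum_shift _ (e j)); apply: eq_bigr => x _.
by rewrite [e j + x]addrC addrK FC.
Qed.

End Neighbours.

(** * Nearest-neighbour correlations against entropy and energy *)

Section Correlations.
Variables (R : realType) (d n : nat) (rho : R).
Hypotheses (n_gt2 : (2 < n)%N) (rho_gt0 : 0 < rho) (rho_lt1 : rho < 1).
Variable m : Omega d n -> R.
Hypotheses (m_prob : is_probability m).
Implicit Types (i j : 'I_d) (x y z w : torus d n) (eta : Omega d n) (l : nat).

Let e j := unit_vec 'Z_n j.
Let H := relative_entropy m (bernoulli_product rho).
Let N : R := #|torus d n|%:R.

Lemma relative_entropy_bernoulli_ge0 : 0 <= H.
Proof. by case: m_prob => m0 m1; exact: entropy_bernoulli_ge0. Qed.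

Lemma pair_correlationC x y :
  pair_correlation rho m x y = pair_correlation rho m y x.
Proof. by apply: eq_bigr => eta _; rewrite [X in _ * X]mulrC. Qed.

Lemma pair_correlation_le1 x y : pair_correlation rho m x y <= 1.
Proof.
case: m_prob => m0 m1; rewrite -m1; apply: ler_sum => eta _.
rewrite ler_piMr //.
have c1 z : `|centered rho z eta| <= 1.
  have := rho_gt0; have := rho_lt1.
  by rewrite /centered ler_norml; case: (eta z) => /=; lra.
apply: le_trans (ler_norm _) _; rewrite normrM -[leRHS]mulr1.
by apply: ler_pM.
Qed.

Lemma conv_swap l i j w eta : (l.+3 <= n)%N ->
  conv (flow_kernel R l i j)
    (fun z => centered rho z (finfun (exchange w (w + e i) eta) : Omega d n)) w =
  conv (flow_kernel R l i j) (fun z => centered rho z eta) w.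
Proof.
move=> ln; apply: eq_bigr => z _.
have [->|z0] := eqVneq z 0; first by rewrite flow_kernel0 // !mul0r.
have [->|ze] := eqVneq z (e i); first by rewrite flow_kernel_unit // !mul0r.
congr (_ * _); rewrite /centered ffunE /exchange.
rewrite -[X in _ == X]addr0 (inj_eq (addrI w)) (negbTE z0).
by rewrite (inj_eq (addrI w)) (negbTE ze).
Qed.

Lemma correlation_bound l j (beta : R) : (l.+3 <= n)%N -> 0 < beta ->
  \sum_x pair_correlation rho m x (x + e j) <=
  4 * H + 2 * N * l.+1%:R^-1 ^+ d +
  beta / 4 * \sum_x \sum_i swap_energy rho m x i +
  d%:R * beta^-1 * (4 * l%:R ^+ 2 * H +
    2 * N * (2 * \sum_(k < l) k.+1%:R * k.+1%:R^-1 ^+ d)).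
Proof.
move=> ln b0; have [m0 m1] := m_prob; have H0 := relative_entropy_bernoulli_ge0.
have ln' : (l < n)%N by apply: leq_trans ln; rewrite leqW.
pose cen eta z := centered rho z eta.
pose K i : torus d n -> R := flow_kernel R l i j.
have -> : \sum_x pair_correlation rho m x (x + e j) =
    \sum_eta m eta * (\sum_x cen eta x * conv (box_kernel R l j) (cen eta) x) +
    \sum_i \sum_w \sum_eta m eta * ((cen eta w - cen eta (w + e i)) *
      conv (K i) (cen eta) w).
  rewrite exchange_big /=.
  transitivity (\sum_eta (m eta * (\sum_x cen eta x * conv (box_kernel R l j) (cen eta) x)
     + \sum_i \sum_w m eta * ((cen eta w - cen eta (w + e i)) *
      conv (K i) (cen eta) w))).
    apply: eq_bigr => eta _; rewrite -mulr_sumr.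
    rewrite (correlation_decomposition n_gt2 (cen eta) j ln') mulrDr; congr (_ + _).
    rewrite mulr_sumr; apply: eq_bigr => i _.
    by rewrite mulr_sumr.
  rewrite big_split /=; congr (_ + _).
  by rewrite exchange_big /=; apply: eq_bigr => i _; rewrite exchange_big.
(* First the box average, by [expect_conv_bilinear]; then the flow terms, integrated by parts bond
   by bond. *)
rewrite -addrA; apply: lerD.
  have B := @expect_conv_bilinear R (torus d n) rho rho_gt0 rho_lt1 m m0 m1
    (box_kernel R l j) _ _ _.
  apply: le_trans (B _ _ _) _.
  - by move=> z; exact: box_ge0.
  - rewrite (sum_box_kernel _ id) sum_box //.
  - exact: box_kernel0.
  rewrite lerD2l -/N ler_wpM2l ?mulr_ge0 //.
  rewrite (sum_box_kernel _ (fun u => u ^+ 2)).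
  by apply: sum_box_sqr.
have sum_h i : \sum_w \sum_eta m eta * conv (K i) (cen eta) w ^+ 2 <=
    4 * l%:R ^+ 2 * H + 2 * N * (2 * \sum_(k < l) k.+1%:R * k.+1%:R^-1 ^+ d).
  rewrite exchange_big /=; under eq_bigr do rewrite -mulr_sumr.
  have K0 z : 0 <= K i z by exact: flow_ge0.
  apply: le_trans (@expect_conv_sqr R (torus d n) rho rho_gt0 rho_lt1 m m0 m1 _ K0) _.
  apply: lerD.
    rewrite ler_wpM2r // ler_wpM2l // lerXn2r ?nnegrE ?sumr_ge0 //.
    by rewrite /K (sum_flow_kernel _ id) sum_flow.
  rewrite ler_wpM2l ?mulr_ge0 // /K (sum_flow_kernel _ (fun u => u ^+ 2)).
  exact: sum_flow_sqr.
apply: (@le_trans _ _ (\sum_i (beta / 4 * (\sum_w swap_energy rho m w i) +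
   beta^-1 * (4 * l%:R ^+ 2 * H +
    2 * N * (2 * \sum_(k < l) k.+1%:R * k.+1%:R^-1 ^+ d))))).
  apply: ler_sum => i _.
  apply: (@le_trans _ _ (\sum_w (beta / 4 * swap_energy rho m w i +
     beta^-1 * \sum_eta m eta * conv (K i) (cen eta) w ^+ 2))).
    apply: ler_sum => w _.
    apply: (@swap_integration_by_parts R d n rho rho_gt0 rho_lt1 m m_prob w i
       (fun eta => conv (K i) (cen eta) w)) => // eta.
    exact: conv_swap.
  rewrite big_split /= -!mulr_sumr lerD2l ler_wpM2l ?invr_ge0 ?(ltW b0) //.
have -> : \sum_x \sum_i swap_energy rho m x i = \sum_i \sum_x swap_energy rho m x i.
  exact: exchange_big.
rewrite big_split /= -mulr_sumr lerD2l.
by rewrite sumr_const card_ord -[leRHS]mulrA [leRHS]mulr_natl.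
Qed.

End Correlations.

(** * Choice of the scale *)

Section Scale.
Variables (R : realType) (d : nat).
Hypothesis d_gt0 : (0 < d)%N.
Implicit Types (n l : nat) (a : R).

(** Half of the bound in [sum_flow_sqr]. It is of order l, log l or 1 for d = 1, d = 2 or d >= 3,
    which is how the dimension enters. *)
Definition flow_size l : R := \sum_(k < l) k.+1%:R * k.+1%:R^-1 ^+ d.

Lemma entropy_error_ge0 a n : 0 <= a -> 0 <= entropy_error d a n.
Proof.
move=> a0; rewrite /entropy_error; case: ifP => _; first exact: sqrtr_ge0.
case: ifP => _; last by rewrite mulr_ge0 // exprn_ge0.
case: n => [|n]; first by rewrite ln0 ?mulr0.
by rewrite mulr_ge0 // ln_ge0 // ler1n.
Qed.

Lemma ln3_gt0 : 0 < ln 3 :> R.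
Proof. by rewrite ln_gt0 // ltr1n. Qed.

Lemma le_ln3 n : (2 < n)%N -> 1 <= (ln 3)^-1 * ln n%:R :> R.
Proof.
move=> n2; rewrite mulrC ler_pdivlMr ?ln3_gt0 // mul1r.
by rewrite ler_ln ?posrE ?ltr0n ?ler_nat // (ltn_trans _ n2).
Qed.

Lemma entropy_error_gt0 a n : 0 < a -> (2 < n)%N -> 0 < entropy_error d a n.
Proof.
move=> a0 n2; rewrite /entropy_error; case: ifP => _; first by rewrite sqrtr_gt0.
case: ifP => _; last by rewrite mulr_gt0 // exprn_gt0 // ltr0n (ltn_trans _ n2).
by rewrite mulr_gt0 // ln_gt0 // ltr1n (ltn_trans _ n2).
Qed.

(** The increment 1 / (n + 2) is at most ln ((n + 2) / (n + 1)), by ln (1 + x) <= x at x = - 1 / (n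
    + 2). *)
Lemma harmonic_le n : \sum_(k < n.+1) k.+1%:R^-1 <= 1 + ln n.+1%:R :> R.
Proof.
elim: n => [|n IH]; first by rewrite big_ord1 invr1 ln1 addr0.
rewrite big_ord_recr /=.
have n1 : 0 < n.+1%:R :> R by rewrite ltr0n.
have n2 : 0 < n.+2%:R :> R by rewrite ltr0n.
suff H : n.+2%:R^-1 <= ln n.+2%:R - ln n.+1%:R :> R.
  by rewrite -(subrK (ln n.+1%:R) (ln n.+2%:R)) [X in 1 + X]addrC addrA lerD.
rewrite -ln_div ?posrE // -[_ / _]invrK lnV ?posrE ?invr_gt0 ?divr_gt0 // lerNr invf_div.
have -> : n.+1%:R / n.+2%:R = 1 + (- n.+2%:R^-1) :> R.
  by rewrite -!natr1; field; rewrite !natr1 pnatr_eq0.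
by apply: le_ln1Dx; rewrite ltrN2 invf_lt1 // ltr1n.
Qed.

Lemma flow_size_le n l : (0 < n)%N -> (l <= n)%N ->
  flow_size l <= if d == 1%N then l%:R else if d == 2%N then 1 + ln n%:R else 2.
Proof.
move=> n0 ln.
have k0 (k : nat) : k.+1%:R != 0 :> R by rewrite pnatr_eq0.
have step D (k : nat) : k.+1%:R * k.+1%:R^-1 ^+ D.+1 = k.+1%:R^-1 ^+ D :> R.
  by rewrite exprS mulrA divff // mul1r.
case: ifP => [/eqP d1|/negbT dn1].
  rewrite /flow_size d1 (eq_bigr (fun=> 1)) => [|k _]; last by rewrite step expr0.
  by rewrite sumr_const card_ord.
case: ifP => [/eqP d2|/negbT dn2].
  rewrite /flow_size d2 (eq_bigr (fun k : 'I_l => k.+1%:R^-1)) => [|k _]; last first.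
    by rewrite step expr1.
  case: l ln => [|l] ln.
    by rewrite big_ord0 addr_ge0 // ln_ge0 // ler1n.
  apply: le_trans (harmonic_le _) _; rewrite lerD2l ler_ln ?posrE ?ltr0n // ler_nat //.
have [->|l0] := posnP l; first by rewrite /flow_size big_ord0.
(* For d >= 3 the terms are at most (k + 1)^-2; the sharper bound 2 - 1 / l is the one that passes
   through the induction. *)
apply: (@le_trans _ _ (2 - l%:R^-1)); last by rewrite gerBl invr_ge0.
have [D dD] : exists D, d = D.+3.
  by exists (d - 3)%N; case: (d) d_gt0 dn1 dn2 => [|[|[|D]]] // _ _ _; rewrite !subSS subn0.
case: l l0 {ln} => // l _.
apply: (@le_trans _ _ (\sum_(k < l.+1) k.+1%:R^-1 ^+ 2)).
  apply: ler_sum => k _; rewrite dD step -addn2 exprD ler_piMl ?sqr_ge0 //.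
  by rewrite exprn_ile1 ?invr_ge0 // invf_le1 ?ltr0n // ler1n.
elim: l => [|l IH]; first by rewrite big_ord1 invr1 expr1n; lra.
rewrite big_ord_recr /=.
have E : l.+1%:R^-1 - l.+2%:R^-1 = l.+1%:R^-1 * l.+2%:R^-1 :> R.
  by have := k0 l; have := k0 l.+1; rewrite -!natr1 => h1 h2; field; rewrite h1 h2.
have F : l.+2%:R^-1 ^+ 2 <= l.+1%:R^-1 * l.+2%:R^-1 :> R.
  by rewrite expr2 ler_wpM2r ?invr_ge0 // lef_pV2 ?posrE ?ltr0n // ler_nat.
move: E F IH; move: (l.+1%:R^-1) (l.+2%:R^-1) => u v E F IH; lra.
Qed.

(** [l.+1] is the integer part of n / sqrt a. It is at least 1 because [a <= n%:R ^+ 2], and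
    [9 <= a] gives 3 (l + 1) <= n, which leaves the room [l.+3 <= n]. *)
Lemma scale_choice : exists2 C : R, 0 <= C & forall n a,
  (2 < n)%N -> 9 <= a -> a <= n%:R ^+ 2 ->
  exists l, [/\ (l.+3 <= n)%N, a * l%:R ^+ 2 <= n%:R ^+ 2,
    n%:R ^+ d * l.+1%:R^-1 ^+ d <= C * entropy_error d a n &
    a / n%:R ^+ 2 * (n%:R ^+ d * flow_size l) <= C * entropy_error d a n].
Proof.
(* In dimension 2 constants are absorbed by the logarithm, since 1 <= kap ln n for n >= 3. *)
pose kap : R := (ln 3)^-1.
have kap0 : 0 <= kap by rewrite invr_ge0 ltW // ln3_gt0.
have p2 : 1 <= 2 ^+ d :> R by rewrite exprn_ege1 // ler1n.
exists (2 ^+ d * (1 + kap) + (1 + kap) + 2).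
  by rewrite !addr_ge0 // mulr_ge0 ?addr_ge0 // (le_trans _ p2).
move=> n a n2 a9 an; set C := _ + 2.
have a0 : 0 < a by apply: lt_le_trans a9.
have n0 : 0 < n%:R :> R by rewrite ltr0n (ltn_trans _ n2).
pose s := Num.sqrt a.
have s2 : s ^+ 2 = a by rewrite sqr_sqrtr // ltW.
have s0 : 0 < s by rewrite sqrtr_gt0.
have s3 : 3 <= s.
  by rewrite -(@ler_sqr R) ?nnegrE ?(ltW s0) // s2 (_ : 3 ^+ 2 = 9) // -natrX.
have sn : s <= n%:R.
  by rewrite -(@ler_sqr R) ?nnegrE ?(ltW s0) ?(ltW n0) // s2.
pose q := n%:R / s.
have q1 : 1 <= q by rewrite ler_pdivlMr // mul1r.
have /andP[Lq qL] := truncn_itv (le_trans ler01 q1).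
have : (0 < Num.truncn q)%N by rewrite -(ltr_nat R) -(ltrD2r 1) add0r natr1 (le_lt_trans q1).
case E : (Num.truncn q) => [//|l] _; rewrite E in Lq qL.
exists l.
have L0 : 0 < l.+1%:R :> R by rewrite ltr0n.
have sL : s * l.+1%:R <= n%:R by rewrite mulrC -ler_pdivlMr.
have nL : n%:R / l.+1%:R <= 2 * s.
  rewrite ler_pdivrMr //; move: qL; rewrite ltr_pdivrMr // => /ltW H.
  apply: le_trans H _; rewrite -mulrA [s * _]mulrC mulrA ler_wpM2r ?(ltW s0) //.
  rewrite -(natr1 l.+1).
  by have : 1 <= l.+1%:R :> R; [rewrite ler1n | lra].
have ll1 : l%:R <= l.+1%:R :> R by rewrite ler_nat.
have sl : s * l%:R <= n%:R by apply: le_trans sL; rewrite ler_wpM2l // ltW.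
have l3 : (l.+3 <= n)%N.
  have : (3 * l.+1)%:R <= n%:R :> R.
    by rewrite natrM; apply: le_trans sL; rewrite ler_wpM2r // ltW.
  by rewrite ler_nat; apply: leq_trans; rewrite mulnS -addn3 addnC leq_add2l leq_pmull.
have nLd : n%:R ^+ d * l.+1%:R^-1 ^+ d <= 2 ^+ d * s ^+ d.
  rewrite -!exprMn lerXn2r ?nnegrE ?mulr_ge0 ?invr_ge0 ?(ltW s0) ?(ltW n0) //.
have fl := @flow_size_le n l (ltnW (ltnW n2)) (ltnW (ltnW (ltnW l3))).
have R0 := entropy_error_ge0 n (ltW a0).
have CR x : x <= (2 ^+ d * (1 + kap)) * entropy_error d a n \/
    x <= (1 + kap + 2) * entropy_error d a n -> x <= C * entropy_error d a n.
  have k1 : 0 <= 1 + kap by rewrite addr_ge0.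
  have k2 : 0 <= 2 ^+ d * (1 + kap) by rewrite mulr_ge0 // (le_trans _ p2).
  case=> /le_trans; apply; rewrite ler_wpM2r // /C; lra.
split=> //.
- by rewrite -s2 -exprMn lerXn2r ?nnegrE ?mulr_ge0 ?(ltW s0) ?(ltW n0).
- apply: (le_trans nLd); apply: CR; left.
  rewrite -mulrA ler_wpM2l ?(le_trans _ p2) // /entropy_error.
  case: ifP => [/eqP ->|/negbT dn1]; first by rewrite expr1 -/s mulrDl mul1r lerDl mulr_ge0 // ltW.
  case: ifP => [/eqP ->|/negbT dn2].
    rewrite s2 mulrCA ler_peMr ?(ltW a0) // mulrDl mul1r.
    have := le_ln3 n2; have : 0 <= ln n%:R :> R by rewrite ln_ge0 // ler1n (ltn_trans _ n2).
    rewrite -/kap; lra.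
  (* Here s^d = a s^(d - 2), and s <= n. *)
  apply: (@le_trans _ _ (a * n%:R ^+ (d - 2))).
    rewrite -{1}(subnK (_ : 2 <= d)%N); last by case: (d) d_gt0 dn1 dn2 => [|[|[|]]].
    rewrite exprD s2 mulrC ler_wpM2l ?(ltW a0) // lerXn2r ?nnegrE ?(ltW s0) ?(ltW n0) //.
  by rewrite mulrDl mul1r lerDl mulr_ge0 // mulr_ge0 ?exprn_ge0 ?(ltW a0) ?(ltW n0).
- apply: CR; right.
  apply: (@le_trans _ _ (a / n%:R ^+ 2 * (n%:R ^+ d *
      (if d == 1%N then l%:R else if d == 2%N then 1 + ln n%:R else 2)))).
    rewrite ler_wpM2l ?divr_ge0 ?exprn_ge0 ?(ltW a0) ?(ltW n0) //.
    by rewrite ler_wpM2l // exprn_ge0 // ltW.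
  move: R0; rewrite /entropy_error.
  case: ifP => [/eqP ->|/negbT dn1] R0.
    rewrite expr1 -/s in R0 *; apply: (@le_trans _ _ s); last by rewrite ler_peMl //; lra.
    rewrite [leLHS](_ : _ = s * (s * l%:R / n%:R)); last first.
      by rewrite -s2; field; rewrite gt_eqF.
    by rewrite ler_piMr ?(ltW s0) // ler_pdivrMr // mul1r.
  case: ifP R0 => [/eqP ->|/negbT dn2] R0.
    rewrite mulrA divfK ?expf_neq0 ?gt_eqF // mulrCA ler_wpM2l ?(ltW a0) //.
    have := le_ln3 n2; have : 0 <= ln n%:R :> R by rewrite ln_ge0 // ler1n (ltn_trans _ n2).
    rewrite -/kap; lra.
  rewrite -{1}(subnK (_ : 2 <= d)%N); last by case: (d) d_gt0 dn1 dn2 => [|[|[|]]].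
  rewrite exprD [leLHS](_ : _ = 2 * (a * n%:R ^+ (d - 2))); last first.
    by field; rewrite gt_eqF.
  by rewrite ler_wpM2r //; lra.
Qed.

End Scale.

(** * Bounds on the entropy production *)

Section ProductionBounds.
Variables (R : realType) (d n : nat) (c : 'I_d -> config d -> R) (c0 an rho : R).
Hypotheses (d_gt0 : (0 < d)%N) (c0_gt0 : 0 < c0) (c_ge : forall j w, c0 <= c j w)
  (an_gt0 : 0 < an) (rho_gt0 : 0 < rho) (rho_lt1 : rho < 1)
  (c_cyl : forall j, cylinder (c j)) (c_large : large_enough c n)
  (c_indep : forall j, ~ dep_support (c j) 0 /\ ~ dep_support (c j) (unit_vec int j)).
Variable m : Omega d n -> R.
Hypotheses (m_prob : is_probability m)
  (m_closed : forall eta, m eta = 0 ->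
     kernel_adj (jump_rate (bond_rate c an) (@bond_map d n)) m eta = 0).

Let nu := bernoulli_product (d := d) (n := n) rho.
Let chi : R := rho * (1 - rho).
Let production := entropy_production (bond_rate c an) (@bond_map d n) nu m.
Let correlation : R :=
  \sum_j \sum_x pair_correlation rho m x (x + unit_vec 'Z_n j).
Let energy : R := \sum_x \sum_j swap_energy rho m x j.

Let n_gt2 : (2 < n)%N. Proof. by case: c_large. Qed.

Let chi0 : 0 < chi. Proof. by rewrite mulr_gt0 // subr_gt0. Qed.

Let coef0 : 0 <= 2 * an / chi.
Proof. by apply: divr_ge0; [apply: mulr_ge0 => //|]; exact: ltW. Qed.

Lemma production_le_correlation :
  production <= 2 * an / chi * correlation - n%:R ^+ 2 * c0 * energy.
Proof.
apply: le_trans (entropy_production_correlation c0_gt0 c_ge an_gt0 rho_gt0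
  rho_lt1 c_cyl c_large c_indep m_prob m_closed) _.
rewrite (sum_neighbours n_gt2 (@pair_correlationC R d n rho m)).
rewrite -/correlation -/energy -/chi lerD2r.
by rewrite mulrA [an / chi * 2]mulrC mulrA.
Qed.

Lemma card_torus : #|torus d n|%:R = n%:R ^+ d :> R.
Proof. by rewrite card_mx card_ord mul1n (Zp_trunc_succ2 n_gt2) natrX. Qed.

Lemma energy_ge0 : 0 <= energy.
Proof.
apply: sumr_ge0 => x _; apply: sumr_ge0 => j _; apply: sumr_ge0 => eta _.
by rewrite mulr_ge0 ?sqr_ge0 // ltW // bernoulli_gt0.
Qed.

(** Drop the energy and bound each pair correlation by 1. *)
Lemma production_trivial_bound :
  production <= 2 * d%:R / chi * an * n%:R ^+ d.
Proof.
apply: le_trans production_le_correlation _.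
apply: (@le_trans _ _ (2 * an / chi * correlation)).
  by rewrite gerBl !mulr_ge0 ?energy_ge0 ?exprn_ge0 // ltW.
have C : correlation <= d%:R * n%:R ^+ d.
  apply: (@le_trans _ _ (\sum_(j < d) \sum_(x : torus d n) 1)).
    by apply: ler_sum => j _; apply: ler_sum => x _; exact: pair_correlation_le1.
  by rewrite !sumr_const card_ord card_torus -[leLHS]mulr_natl.
rewrite [leRHS](_ : _ = 2 * an / chi * (d%:R * n%:R ^+ d)); last by ring.
exact: ler_wpM2l.
Qed.

Lemma production_scale_bound l : (l.+3 <= n)%N ->
  production <= 2 * an / chi * (d%:R *
    (4 * relative_entropy m nu + 2 * n%:R ^+ d * l.+1%:R^-1 ^+ d +
     d%:R * (an * d%:R / (2 * n%:R ^+ 2 * c0 * chi)) *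
      (4 * l%:R ^+ 2 * relative_entropy m nu +
       2 * n%:R ^+ d * (2 * flow_size R d l)))).
Proof.
move=> ln.
have n0 : 0 < n%:R :> R by rewrite ltr0n (ltn_trans _ n_gt2).
have d0 : 0 < d%:R :> R by rewrite ltr0n.
(* beta is chosen so that the exchange energy produced by the integrations by
   parts is exactly the one dissipated by the stirring dynamics *)
pose beta : R := 2 * n%:R ^+ 2 * c0 * chi / (an * d%:R).
have b0 : 0 < beta.
  apply: divr_gt0; last exact: mulr_gt0.
  do 2!apply: mulr_gt0 => //; apply: mulr_gt0 => //; exact: exprn_gt0.
have bV : beta^-1 = an * d%:R / (2 * n%:R ^+ 2 * c0 * chi) by rewrite invf_div.
apply: le_trans production_le_correlation _.
set Q := 4 * relative_entropy m nu + 2 * n%:R ^+ d * l.+1%:R^-1 ^+ d + _.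
have C : correlation <= d%:R * (Q + beta / 4 * energy).
  apply: (@le_trans _ _ (\sum_(j < d) (Q + beta / 4 * energy))); last first.
    by rewrite sumr_const card_ord -[leLHS]mulr_natl.
  apply: ler_sum => j _.
  apply: le_trans (correlation_bound n_gt2 rho_gt0 rho_lt1 m_prob j ln b0) _.
  by rewrite card_torus -/nu -/energy bV addrAC.
apply: (@le_trans _ _ (2 * an / chi * (d%:R * (Q + beta / 4 * energy)) -
    n%:R ^+ 2 * c0 * energy)).
  by rewrite lerD2r; exact: ler_wpM2l.
rewrite [leLHS](_ : _ = 2 * an / chi * (d%:R * Q)) //.
rewrite !mulrDr -addrA [X in _ + X](_ : _ = 0) ?addr0 //.
by rewrite /beta; field; rewrite !gt_eqF.
Qed.

End ProductionBounds.

(** * Uniformity in n *)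

Section MainBound.
Variables (R : realType) (d : nat) (c : 'I_d -> config d -> R) (c0 rho : R).
Hypotheses (d_gt0 : (0 < d)%N) (c0_gt0 : 0 < c0) (c_ge : forall j w, c0 <= c j w)
  (rho_gt0 : 0 < rho) (rho_lt1 : rho < 1)
  (c_cyl : forall j, cylinder (c j))
  (c_indep : forall j, ~ dep_support (c j) 0 /\ ~ dep_support (c j) (unit_vec int j)).
Variable a : nat -> R.
Hypotheses (a_gt0 : forall n, (0 < n)%N -> 0 < a n) (a_infty : a n @[n --> \oo] --> +oo).

(** As [a n] tends to infinity, [a n < 9] holds for finitely many [n] only; the sum of the ratios
    below a threshold dominates each of them. *)
Lemma finitely_many_small : exists2 M : R, 0 <= M &
  forall n, (2 < n)%N -> a n < 9 -> n%:R ^+ d <= M * entropy_error d (a n) n.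
Proof.
have /cvgryPge/(_ 9) [N _ HN] := a_infty.
pose T n : R := `|n%:R ^+ d / entropy_error d (a n) n|.
exists (\sum_(n < N) T n); first by apply: sumr_ge0 => i _; exact: normr_ge0.
move=> n n2 an9.
have nN : (n < N)%N.
  by rewrite ltnNge; apply/negP => Nn; have := HN n Nn; rewrite /= leNgt an9.
have R0 : 0 < entropy_error d (a n) n.
  by apply: entropy_error_gt0 => //; apply: a_gt0; rewrite (ltn_trans _ n2).
rewrite -ler_pdivrMr // (bigD1 (Ordinal nN)) //=.
apply: le_trans (ler_norm _) _; rewrite lerDl.
by apply: sumr_ge0 => i _; exact: normr_ge0.
Qed.

Lemma production_bound : exists2 C : R, 0 <= C &
  forall n, large_enough c n -> forall m : Omega d n -> R, is_probability m ->
  (forall eta, m eta = 0 ->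
     kernel_adj (jump_rate (bond_rate c (a n)) (@bond_map d n)) m eta = 0) ->
  entropy_production (bond_rate c (a n)) (@bond_map d n) (bernoulli_product rho) m <=
  C * a n * (relative_entropy m (bernoulli_product rho) + entropy_error d (a n) n).
Proof.
have [M M0 HM] := finitely_many_small.
have [S S0 HS] := scale_choice R d_gt0.
pose chi : R := rho * (1 - rho).
have chi0 : 0 < chi by rewrite mulr_gt0 // subr_gt0.
(* [K1] serves the trivial bound, used when [a n < 9] or [a n > n%:R ^+ 2]; [K2] serves the scale
   given by [scale_choice]. *)
pose K1 : R := 2 * d%:R / chi * (M + 1 + (ln 3)^-1).
pose K2 : R := 2 * d%:R / chi * (4 + 2 * S + d%:R * d%:R / (2 * c0 * chi) * (4 + 4 * S)).
have kap0 : 0 <= (ln 3)^-1 :> R by rewrite invr_ge0 ltW // ln3_gt0.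
have D0 : 0 <= 2 * d%:R / chi.
  by apply: divr_ge0; [exact: mulr_ge0|exact: ltW].
have E0 : 0 <= d%:R * d%:R / (2 * c0 * chi).
  apply: divr_ge0; first exact: mulr_ge0.
  by apply: mulr_ge0; [apply: mulr_ge0 => //|]; exact: ltW.
have K10 : 0 <= K1 by apply: mulr_ge0 => //; rewrite !addr_ge0.
have K20 : 0 <= K2.
  apply: mulr_ge0 => //; apply: addr_ge0; first by rewrite addr_ge0 // mulr_ge0.
  by apply: mulr_ge0 => //; rewrite addr_ge0 // mulr_ge0.
exists (K1 + K2) => [|n c_large m m_prob m_closed]; first by rewrite addr_ge0.
have n2 : (2 < n)%N by case: c_large.
have n0 : 0 < n%:R :> R by rewrite ltr0n (ltn_trans _ n2).
have n1 : 1 <= n%:R :> R by rewrite ler1n (ltn_trans _ n2).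
have an0 : 0 < a n by apply: a_gt0; rewrite (ltn_trans _ n2).
have H0 := relative_entropy_bernoulli_ge0 rho_gt0 rho_lt1 m_prob.
set H := relative_entropy _ _ in H0 *.
have R0 := entropy_error_ge0 d n (ltW an0).
set err := entropy_error d (a n) n in R0 *.
have trivial : n%:R ^+ d <= (M + 1 + (ln 3)^-1) * err ->
    entropy_production (bond_rate c (a n)) (@bond_map d n) (bernoulli_product rho) m
    <= (K1 + K2) * a n * (H + err).
  move=> nerr.
  apply: le_trans (production_trivial_bound c0_gt0 c_ge an0 rho_gt0 rho_lt1
    c_cyl c_large c_indep m_prob m_closed) _.
  rewrite -/chi; apply: (@le_trans _ _ (K1 * a n * err)).
    rewrite [leRHS](_ : _ = 2 * d%:R / chi * a n * ((M + 1 + (ln 3)^-1) * err)); last first.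
      by rewrite /K1; ring.
    by rewrite ler_wpM2l // mulr_ge0 // ltW.
  apply: ler_pM => //; first by rewrite mulr_ge0 // ltW.
    by rewrite ler_wpM2r ?(ltW an0) // lerDl.
  by rewrite lerDr.
have [a9|a9] := ltP (a n) 9.
  apply: trivial; apply: le_trans (HM n n2 a9) _.
  by rewrite ler_wpM2r // -addrA lerDl addr_ge0.
have [an|an] := leP (a n) (n%:R ^+ 2); last first.
  (* Now n^2 < a_n, so n^d is at most the error term; the factor 1 + 1 / ln 3 makes up for the
     logarithm in dimension 2. *)
  apply: trivial; apply: (@le_trans _ _ ((1 + (ln 3)^-1) * err)); last first.
    by rewrite ler_wpM2r // lerD2r lerDr.
  rewrite /err /entropy_error; case: ifP => [/eqP ->|/negbT dn1].
    rewrite expr1; apply: (@le_trans _ _ (Num.sqrt (a n))).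
      rewrite -[leLHS](ger0_norm (ltW n0)) -sqrtr_sqr ler_wsqrtr //; exact: ltW.
    by rewrite ler_peMl ?sqrtr_ge0 // lerDl.
  case: ifP => [/eqP ->|/negbT dn2].
    apply: le_trans (ltW an) _; rewrite mulrCA ler_peMr ?(ltW an0) //.
    apply: le_trans (le_ln3 R n2) _; rewrite ler_wpM2r ?ln_ge0 // lerDr //.
  rewrite -{1}(subnK (_ : 2 <= d)%N); last by case: (d) d_gt0 dn1 dn2 => [|[|[|]]].
  rewrite exprD mulrC; apply: (@le_trans _ _ (a n * n%:R ^+ (d - 2))).
    by rewrite ler_wpM2r ?exprn_ge0 ?(ltW n0) // ltW.
  by rewrite ler_peMl ?mulr_ge0 ?exprn_ge0 ?(ltW an0) ?(ltW n0) // lerDl.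
have [l [ln al nl fl]] := HS n (a n) n2 a9 an.
rewrite -/err in nl fl.
apply: le_trans (production_scale_bound d_gt0 c0_gt0 c_ge an0 rho_gt0 rho_lt1
  c_cyl c_large c_indep m_prob m_closed ln) _.
rewrite -/chi -/H.
(* This ratio multiplies [H] in the flow term; the choice of [l] keeps it bounded. *)
have al1 : a n * l%:R ^+ 2 / n%:R ^+ 2 <= 1.
  by rewrite ler_pdivrMr ?exprn_gt0 // mul1r.
apply: (@le_trans _ _ (K2 * a n * (H + err))); last first.
  have q0 : 0 <= a n * (H + err) by apply: mulr_ge0; [exact: ltW|exact: addr_ge0].
  by rewrite -[leLHS]mulrA -[leRHS]mulrA ler_wpM2r // lerDr.
rewrite [leLHS](_ : _ = a n * (2 * d%:R / chi) * (4 * H + 2 * (n%:R ^+ d * l.+1%:R^-1 ^+ d) +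
    d%:R * d%:R / (2 * c0 * chi) * (4 * (a n * l%:R ^+ 2 / n%:R ^+ 2) * H +
      4 * (a n / n%:R ^+ 2 * (n%:R ^+ d * flow_size R d l))))); last first.
  by field; rewrite !gt_eqF.
rewrite [leRHS](_ : _ = a n * (2 * d%:R / chi) * ((4 + 2 * S +
    d%:R * d%:R / (2 * c0 * chi) * (4 + 4 * S)) * (H + err))); last first.
  by rewrite /K2; ring.
apply: ler_wpM2l; first by rewrite mulr_ge0 // ltW.
have SH : 0 <= S * H by rewrite mulr_ge0.
have XH : a n * l%:R ^+ 2 / n%:R ^+ 2 * H <= H by rewrite ler_piMl.
move: nl fl XH {al al1}.
move: (n%:R ^+ d * l.+1%:R^-1 ^+ d) (a n * l%:R ^+ 2 / n%:R ^+ 2)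
  (a n / n%:R ^+ 2 * (n%:R ^+ d * flow_size R d l)) => u X v nl fl XH.
rewrite [leRHS]mulrDl; apply: lerD; first by move: nl SH R0 H0; lra.
by rewrite -[leRHS]mulrA; apply: ler_wpM2l => //; move: fl XH SH R0 H0; lra.
Qed.

End MainBound.

Theorem theorem2p7 (R : realType) (d : nat) (d_gt0 : (0 < d)%N)
    (c : 'I_d -> config d -> R) (c0 : R)
    (c_cyl : forall j, cylinder (c j))
    (c0_gt0 : 0 < c0)
    (c_ge : forall j w, c0 <= c j w)
    (c_indep : forall j, ~ dep_support (c j) 0 /\ ~ dep_support (c j) (unit_vec int j))
    (c_grad : gradient_condition c)
    (a : nat -> R)
    (a_gt0 : forall n, (0 < n)%N -> 0 < a n)
    (a_infty : a n @[n --> \oo] --> +oo)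
    (a_small : a n / n%:R ^+ 2 @[n --> \oo] --> 0)
    (rho : R) (rho_gt0 : 0 < rho) (rho_lt1 : rho < 1) :
  exists C0 : R,
    forall n : nat, large_enough c n ->
    forall mu : Omega d n -> R, is_probability mu ->
    forall t : R, 0 <= t ->
    exists2 H' : \bar R,
      is_time_derivative (entropy c (a n) rho mu) t H' &
      (H' <= (C0 * a n *
              (entropy c (a n) rho mu t + entropy_error d (a n) n))%:E)%E.
Proof.
have [C _ HC] := production_bound d_gt0 c0_gt0 c_ge rho_gt0 rho_lt1 c_cyl c_indep
  a_gt0 a_infty.
exists C => n c_large mu mu_prob t t_ge0.
have an0 : 0 < a n by apply: a_gt0; case: c_large => n2 _; apply: ltn_trans n2.
have r0 := bond_rate_ge0 (n := n) c0_gt0 c_ge an0.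
have nu0 := @bernoulli_gt0 R d n rho rho_gt0 rho_lt1.
rewrite /is_time_derivative /entropy (gen_jump n c (a n)).
(* At time 0 the derivative is one-sided and may be [-oo], for which the bound is immediate. *)
have [->|tn0] := eqVneq t 0.
  have [l Hl Hcase] := entropy_right_derivative (@bond_map d n) r0 nu0 mu_prob.
  exists l; first exact: Hl.
  case: Hcase => [->|[mk ->]]; first exact: leNye.
  by rewrite lee_fin law_at0; exact: HC.
have t0 : 0 < t by rewrite lt_neqAle eq_sym tn0.
have [mk dH] := entropy_is_derive (@bond_map d n) r0 nu0 mu_prob t0.
exists (entropy_production (bond_rate c (a n)) (@bond_map d n)
  (bernoulli_product rho)
  (law_at (jump_gen (bond_rate c (a n)) (@bond_map d n)) mu t))%:E.
  by eexists; [reflexivity | exact: dH].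
rewrite lee_fin; apply: HC => //.
exact: law_at_probability.
Qed.
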